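(* Let $A,B\in\mathbb{C}^{n\times m}$ with $n\ge m$, let $r$ be a positive integer with $r\le\operatorname{rank}(B)$, and let $\Omega\subseteq\mathbb{C}$ be nonempty. Assume that for every finite nonempty set $\mathbb{S}\subseteq\Omega$ the optimization problem $\inf_{\mu\in\mathbb{S}^r}\sup_{\Gamma}\sigma_{mr-r+1}(\mathcal{L}(\mu,\Gamma,A,B))$ is attained at some $(\mu_\ast,\Gamma_\ast)$ with $\Gamma_\ast\in\mathbb{C}^{r(r-1)/2}$ finite at which both the multiplicity qualification and the linear independence qualification hold. Then $$\tau_r(\Omega)=\inf_{\mu\in\Omega^r}\ \sup_{\Gamma\in\mathbb{C}^{r(r-1)/2}}\ \sigma_{mr-r+1}\left(\mathcal{L}(\mu,\Gamma,A,B)\right).$$ In particular, when the assumption holds with $\Omega=\mathbb{C}$, the distance to the nearest pencil with $r$ finite eigenvalues satisfies $$\tau_r(\mathbb{C})=\inf_{\mu\in\mathbb{C}^r}\ \sup_{\Gamma\in\mathbb{C}^{r(r-1)/2}}\ \sigma_{mr-r+1}\left(\mathcal{L}(\mu,\Gamma,A,B)\right).$$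
   Context: $\|\cdot\|_2$ is the spectral norm, $\sigma_p(\cdot)$ denotes the $p$th largest singular value, and $\operatorname{vec}$ stacks the columns of a matrix into one vector. $\Omega^r$ is the set of vectors of length $r$ with all entries in $\Omega$. Kronecker canonical form (KCF): for a pencil $A-\lambda B$ with $A,B\in\mathbb{C}^{n\times m}$ there are invertible $P\in\mathbb{C}^{n\times n}$, $Q\in\mathbb{C}^{m\times m}$ such that $P(A-\lambda B)Q$ is block diagonal with blocks of the form $J_p(\alpha)-\lambda I_p$ (regular block for the finite eigenvalue $\alpha$, $p\ge1$), $I_p-\lambda J_p(0)$ (regular block for the infinite eigenvalue, $p\ge 1$), $F_p-\lambda G_p$ (right singular block, $p\ge0$), or $F_p^T-\lambda G_p^T$ (left singular block, $p\ge0$). Here $J_p(\alpha)$ is the $p\times p$ Jordan block with eigenvalue $\alpha$, $F_p=[I_p\ \ 0]$ and $G_p=[0\ \ I_p]$ are $p\times(p+1)$. The algebraic multiplicity of $\lambda_j$ as an eigenvalue of $A-\lambda B$, denoted $m_j(A,B)$, is the sum of the sizes of the regular blocks $J_p(\lambda_j)-\lambda I_p$ in the KCF (zero if there are none). For a finite set $\mathbb{S}=\{\lambda_1,\dots,\lambda_k\}$ of distinct complex numbers, $\tau_r(\mathbb{S}) := \inf\{\|\Delta A\|_2 : \Delta A\in\mathbb{C}^{n\times m},\ \sum_{j=1}^k m_j(A+\Delta A,B)\geq r\}$. For $\Omega\subseteq\mathbb{C}$, $\tau_r(\Omega):=\inf\{\|\Delta A\|_2: (A+\Delta A)-\lambda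 B\text{ has } r \text{ finite eigenvalues in }\Omega\}=\inf_{\mathbb{S}\subseteq\Omega}\tau_r(\mathbb{S})$, where eigenvalues are counted with algebraic multiplicity (''has $r$'' meaning at least $r$) and the last infimum is over finite nonempty $\mathbb{S}\subseteq\Omega$. For $\mu=[\mu_1,\dots,\mu_r]^T\in\mathbb{C}^r$ and $\Gamma=(\gamma_{ij})_{1\le j<i\le r}\in\mathbb{C}^{r(r-1)/2}$, $\mathcal{L}(\mu,\Gamma,A,B)\in\mathbb{C}^{nr\times mr}$ is the block lower triangular matrix with $r\times r$ blocks of size $n\times m$, whose $(i,i)$ block is $A-\mu_iB$, whose $(i,j)$ block is $\gamma_{ij}B$ for $i>j$, and whose $(i,j)$ block is $0$ for $i<j$. Multiplicity qualification at $(\mu,\Gamma)$: the multiplicity of the singular value $\sigma_{mr-r+1}(\mathcal{L}(\mu,\Gamma,A,B))$ is one. Linear independence qualification at $(\mu,\Gamma)$: there is a right singular vector $V$ associated with $\sigma_{mr-r+1}(\mathcal{L}(\mu,\Gamma,A,B))$ such that $\mathcal{V}\in\mathbb{C}^{m\times r}$ with $\operatorname{vec}(\mathcal{V})=V$ has full column rank. *)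

(* Defs.v *)
(* The complex numbers are R[i] for an arbitrary R : realType. *)
From HB Require Import structures.
From mathcomp Require Import all_boot all_order all_algebra.
From mathcomp Require Import finmap.
From mathcomp Require Import complex.
From mathcomp Require Import boolp classical_sets reals ereal.

Set Implicit Arguments.
Unset Strict Implicit.
Unset Printing Implicit Defensive.

Import Order.TTheory GRing.Theory Num.Theory.
Local Open Scope classical_set_scope.
Local Open Scope ring_scope.
Local Open Scope sesquilinear_scope.

Section SingularValues.
Variable R : realType.
Local Notation C := R[i].

(* The square roots of the eigenvalues of the Hermitian matrix M^* M, listed
   with multiplicity in nonincreasing order; spectral_diag lists those
   eigenvalues (which are real) in no particular order.  For a wide matrix the
   k - l structural zeros at the end are discarded. *)
Definition singvals (l k : nat) (M : 'M[C]_(l, k)) : seq R :=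
  let d := spectral_diag (M ^t* *m M) in
  take (minn l k)
    (sort (fun x y : R => y <= x) [seq Num.sqrt (complex.Re (d 0 j)) | j <- enum 'I_k]).

(* p is counted from 1; the value is 0 when p > min(l, k). *)
Definition sigma (p : nat) (l k : nat) (M : 'M[C]_(l, k)) : R :=
  nth 0 (singvals M) p.-1.

Definition specnorm (l k : nat) (M : 'M[C]_(l, k)) : R := sigma 1 M.

Definition right_singular_vector (s : R) (l k : nat) (M : 'M[C]_(l, k))
    (V : 'cV[C]_k) : Prop :=
  exists U : 'cV[C]_l,
    [/\ U ^t* *m U = 1%:M, V ^t* *m V = 1%:M,
        M *m V = (s%:C)%C *: U & M ^t* *m U = (s%:C)%C *: V].

End SingularValues.

Section Kronecker.

(* Regular blocks have size at least 1, so KFinite p a and KInfinite p stand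
   for the blocks of size p.+1, i.e. J_(p.+1)(a) - lambda I and
   I - lambda J_(p.+1)(0); KRight p and KLeft p stand for F_p - lambda G_p and
   its transpose, with p >= 0. *)
Inductive kblock (K : Type) : Type :=
  | KFinite of nat & K
  | KInfinite of nat
  | KRight of nat
  | KLeft of nat.

HB.instance Definition _ (K : Type) := gen_eqMixin (kblock K).
HB.instance Definition _ (K : Type) := gen_choiceMixin (kblock K).

Variable K : fieldType.

Definition jordan_block (p : nat) (a : K) : 'M[K]_p :=
  \matrix_(i, j) (if i == j then a else (i.+1 == j :> nat)%:R).

Definition kF (p : nat) : 'M[K]_(p, p.+1) :=
  \matrix_(i, j) (i == j :> nat)%:R.
Definition kG (p : nat) : 'M[K]_(p, p.+1) :=
  \matrix_(i, j) (i.+1 == j :> nat)%:R.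

Definition kb_rows (b : kblock K) : nat :=
  match b with
  | KFinite p _ => p.+1 | KInfinite p => p.+1 | KRight p => p | KLeft p => p.+1
  end.

Definition kb_cols (b : kblock K) : nat :=
  match b with
  | KFinite p _ => p.+1 | KInfinite p => p.+1 | KRight p => p.+1 | KLeft p => p
  end.

(* The block b is the pencil kb_A b - lambda kb_B b. *)
Definition kb_A (b : kblock K) : 'M[K]_(kb_rows b, kb_cols b) :=
  match b with
  | KFinite p a => jordan_block p.+1 a
  | KInfinite p => 1%:M
  | KRight p => kF p
  | KLeft p => (kF p)^T
  end.

Definition kb_B (b : kblock K) : 'M[K]_(kb_rows b, kb_cols b) :=
  match b with
  | KFinite p a => 1%:M
  | KInfinite p => jordan_block p.+1 0
  | KRight p => kG p
  | KLeft p => (kG p)^T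
  end.

Fixpoint kdiag_rows (s : seq (kblock K)) : nat :=
  if s is b :: s' then (kb_rows b + kdiag_rows s')%N else 0%N.

Fixpoint kdiag_cols (s : seq (kblock K)) : nat :=
  if s is b :: s' then (kb_cols b + kdiag_cols s')%N else 0%N.

Fixpoint kdiag (X : forall b : kblock K, 'M[K]_(kb_rows b, kb_cols b))
    (s : seq (kblock K)) : 'M[K]_(kdiag_rows s, kdiag_cols s) :=
  match s with
  | [::] => 0
  | b :: s' => block_mx (X b) 0 0 (kdiag X s')
  end.

(* P (A - lambda B) Q = diag(blocks), identifying the coefficients of the two
   pencils in lambda. *)
Definition is_kcf (n m : nat) (A B : 'M[K]_(n, m)) (s : seq (kblock K)) : Prop :=
  exists (P : 'M[K]_n) (Q : 'M[K]_m)
         (en : kdiag_rows s = n) (em : kdiag_cols s = m),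
    [/\ P \in unitmx, Q \in unitmx,
        P *m A *m Q = castmx (en, em) (kdiag kb_A s) &
        P *m B *m Q = castmx (en, em) (kdiag kb_B s)].

(* A chosen Kronecker canonical form; it is unique up to the order of the
   blocks.  The default [::] is never used when K is algebraically closed. *)
Definition kcf (n m : nat) (A B : 'M[K]_(n, m)) : seq (kblock K) :=
  xget [::] [set s | is_kcf A B s].

Definition algmult (n m : nat) (A B : 'M[K]_(n, m)) (l : K) : nat :=
  (\sum_(b <- kcf A B)
     (if b is KFinite p a then if a == l then p.+1 else 0 else 0))%N.

End Kronecker.

Section Distance.
Variable R : realType.
Local Notation C := R[i].
Variables (n m : nat).

(* Infima and suprema are taken in the extended reals, so that
   inf(empty set) = +oo and unbounded suprema are +oo. *)
Definition tau_fin (r : nat) (A B : 'M[C]_(n, m)) (S : {fset C}) : \bar R :=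
  ereal_inf [set ((specnorm D)%:E)%E | D in
    [set D : 'M[C]_(n, m) | (r <= \sum_(l <- S) algmult (A + D)%R B l)%N]].

Definition has_eigenvalues_in (r : nat) (A B : 'M[C]_(n, m)) (Omega : set C) :
    Prop :=
  exists S : {fset C}, [/\ S != fset0, [set` S] `<=` Omega &
                           (r <= \sum_(l <- S) algmult A B l)%N].

Definition tau (r : nat) (A B : 'M[C]_(n, m)) (Omega : set C) : \bar R :=
  ereal_inf [set ((specnorm D)%:E)%E | D in
    [set D : 'M[C]_(n, m) | has_eigenvalues_in r (A + D) B Omega]].

Lemma tauE (r : nat) (A B : 'M[C]_(n, m)) (Omega : set C) :
  tau r A B Omega =
  ereal_inf [set tau_fin r A B S | S in
    [set S : {fset C} | S != fset0 /\ [set` S] `<=` Omega]].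
Proof.
apply/eqP; rewrite eq_le; apply/andP; split.
- apply: le_ereal_inf_tmp => _ [S [S0 SO] <-].
  apply: le_ereal_inf_tmp => _ [D rD <-].
  by apply: ge_ereal_inf; exists (specnorm D)%:E => //; exists D => //; exists S.
- apply: le_ereal_inf_tmp => _ [D [S [S0 SO rD]] <-].
  apply: ge_ereal_inf; exists (tau_fin r A B S); first by exists S.
  by apply: ge_ereal_inf; exists (specnorm D)%:E => //; exists D.
Qed.

(* C^(r(r-1)/2), indexed by the pairs (i, j) with j < i. *)
Definition params (r : nat) : Type :=
  {ffun {ij : 'I_r * 'I_r | (ij.2 < ij.1)%N} -> C}.

(* gamma_ij for j < i, and 0 otherwise *)
Definition gamma_entry (r : nat) (Gamma : params r) (i j : 'I_r) : C :=
  if insub (i, j) is Some ij then Gamma ij else 0.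

Definition Lmat (r : nat) (mu : 'cV[C]_r) (Gamma : params r)
    (A B : 'M[C]_(n, m)) : 'M[C]_(\sum_(i < r) n, \sum_(j < r) m) :=
  \mxblock_(i < r, j < r)
    (if i == j then A - mu i 0 *: B else gamma_entry Gamma i j *: B).

Definition vec_stack (r : nat) (X : 'M[C]_(m, r)) : 'cV[C]_(\sum_(j < r) m) :=
  \mxcol_(j < r) col j X.

Definition sigmaL (r : nat) (A B : 'M[C]_(n, m)) (mu : 'cV[C]_r)
    (Gamma : params r) : R :=
  sigma (m * r - r + 1) (Lmat mu Gamma A B).

Definition sup_sigmaL (r : nat) (A B : 'M[C]_(n, m)) (mu : 'cV[C]_r) : \bar R :=
  ereal_sup [set ((sigmaL A B mu Gamma)%:E)%E | Gamma in [set: params r]].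

Definition inf_sup_sigmaL (r : nat) (A B : 'M[C]_(n, m)) (Omega : set C) :
    \bar R :=
  ereal_inf [set sup_sigmaL A B mu | mu in
    [set mu : 'cV[C]_r | forall i, Omega (mu i 0)]].

Definition mult_qualif (r : nat) (A B : 'M[C]_(n, m)) (mu : 'cV[C]_r)
    (Gamma : params r) : Prop :=
  count_mem (sigmaL A B mu Gamma) (singvals (Lmat mu Gamma A B)) = 1%N.

Definition linindep_qualif (r : nat) (A B : 'M[C]_(n, m)) (mu : 'cV[C]_r)
    (Gamma : params r) : Prop :=
  exists X : 'M[C]_(m, r),
    right_singular_vector (sigmaL A B mu Gamma) (Lmat mu Gamma A B)
      (vec_stack X) /\ \rank X = r.

Definition attained_qualified (r : nat) (A B : 'M[C]_(n, m)) (S : set C) :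
    Prop :=
  exists (mu : 'cV[C]_r) (Gamma : params r),
    [/\ (forall i, S (mu i 0)),
        ((sigmaL A B mu Gamma)%:E)%E = sup_sigmaL A B mu,
        sup_sigmaL A B mu = inf_sup_sigmaL r A B S,
        mult_qualif A B mu Gamma & linindep_qualif A B mu Gamma].

Definition qualification (r : nat) (A B : 'M[C]_(n, m)) (Omega : set C) : Prop :=
  forall S : {fset C}, S != fset0 -> [set` S] `<=` Omega ->
    attained_qualified r A B [set` S].

End Distance.

(* Main.v *)
Require Import Defs.
From HB Require Import structures.
From mathcomp Require Import all_boot all_order all_algebra.
From mathcomp Require Import finmap.
From mathcomp Require Import complex.
From mathcomp Require Import boolp classical_sets reals ereal.
From mathcomp Require Import ring lra zify.

(** The block matrix [L (mu, Gamma)] is the matrix of the operator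
    [X |-> A X - B X C] on [m x r] matrices, where [C] is upper triangular with
    diagonal [mu] and the parameters [- Gamma] above it ([Lmat_vec_stack]).

    Lower bound.  If [A + D - lambda B] has [r] eigenvalues in a finite set, its
    canonical form provides [X] of full column rank with [(A + D) X = B X T], where
    [T] is upper triangular with these eigenvalues as diagonal [mu]
    ([is_kcf_invariant]).  For every [Gamma], the upper triangular [Y] with
    [T Y = Y C] form a space of dimension at least [r] ([rank_intertwining]), and
    all [X Y] are in the kernel of the operator of the perturbed pencil.  The
    variational characterization of singular values then bounds the singular value
    number [m r - r + 1] of the unperturbed one by the norm of [D] ([sigmaL_le]).

    Upper bound.  Let [Gamma] be optimal for [mu], let [sigma] be the optimal value
    and let [Y], [X] be unstacked left and right singular vectors.  Since [sigma] is
    simple, it would increase in any direction of nonzero first-order variation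
    ([sigma_increase]); hence [Y^* B X] is upper triangular ([optimum_upper]).  A
    commutator argument then shows, for [sigma > 0], that [X] and [Y] have the same
    Gram matrix ([optimum_gram]), so that [D = - sigma Y X^+] has norm at most [sigma], while
    [(A + D) X = B X C].  The perturbed pencil might be singular, in which case [mu]
    need not consist of eigenvalues; as [rank B >= r] and [n >= m], an arbitrarily
    small further perturbation restores full column rank and keeps such an equation
    ([perturb_injective]).  A pencil of full column rank has a Kronecker canonical
    form ([kcf_exists]), and every such form has at least [r] eigenvalues among the
    entries of [mu] ([is_kcf_spectrum]).

    The infimum over an infinite [Omega] is reduced to finite sets by comparing each
    [mu] with the optimum over the set of its own entries ([tau_eq]). *)

Set Implicit Arguments.
Unset Strict Implicit.
Unset Printing Implicit Defensive.

Import Order.TTheory GRing.Theory Num.Theory.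
Local Open Scope classical_set_scope.
Local Open Scope ring_scope.
Local Open Scope sesquilinear_scope.

(** * Linear algebra *)

Section LinearAlgebra.
Variable K : fieldType.

Lemma mulmx_left_inj m n p (A : 'M[K]_(m, n)) (A' : 'M[K]_(n, m)) (B C : 'M[K]_(n, p)) :
  A' *m A = 1%:M -> A *m B = A *m C -> B = C.
Proof. by move=> AK /(congr1 (mulmx A')); rewrite !mulmxA AK !mul1mx. Qed.

Lemma mulmx_right_inj m n p (A : 'M[K]_(m, n)) (A' : 'M[K]_(n, m)) (B C : 'M[K]_(p, m)) :
  A *m A' = 1%:M -> B *m A = C *m A -> B = C.
Proof. by move=> AK /(congr1 (mulmx^~ A')); rewrite /= -!mulmxA AK !mulmx1. Qed.

(** The idempotent [1 - X F] has a rank factorization [Y G], and idempotency forces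
    [G Y = 1]: a left-invertible matrix [X] is completed to a basis together with
    the dual basis, without casting dimensions. *)
Lemma split_complement p m (X : 'M[K]_(m, p)) (F : 'M[K]_(p, m)) :
  F *m X = 1%:M ->
  exists q (Y : 'M[K]_(m, q)) (G : 'M[K]_(q, m)),
    [/\ G *m Y = 1%:M, F *m Y = 0, G *m X = 0, X *m F + Y *m G = 1%:M
      & (p + q = m)%N].
Proof.
move=> FX1; set E := 1%:M - X *m F.
have EX : E *m X = 0 by rewrite mulmxBl mul1mx -mulmxA FX1 mulmx1 subrr.
have FE : F *m E = 0 by rewrite mulmxBr mulmx1 mulmxA FX1 mul1mx subrr.
have EE : E *m E = E by rewrite {1}/E mulmxBl mul1mx -mulmxA FE mulmx0 subr0.
have [Y' Y'Y] := row_fullP (col_base_full E).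
have [G' GG'] := row_freeP (row_base_free E).
move: (mulmx_base E) Y' G' Y'Y GG'.
move: (\rank E) (col_base E) (row_base E) => q Y G YG Y' G' Y'Y GG'.
have GY1 : G *m Y = 1%:M.
  apply: (mulmx_left_inj Y'Y); apply: (mulmx_right_inj GG').
  by rewrite mulmx1 -!mulmxA YG mulmxA YG EE.
have FY0 : F *m Y = 0.
  by apply: (mulmx_right_inj GG'); rewrite -mulmxA YG FE mul0mx.
have GX0 : G *m X = 0.
  by apply: (mulmx_left_inj Y'Y); rewrite mulmxA YG EX mulmx0.
have XY1 : X *m F + Y *m G = 1%:M by rewrite YG /E addrC subrK.
exists q, Y, G; split => //.
have PQ : row_mx X Y *m col_mx F G = 1%:M by rewrite mul_row_col.
have QP : col_mx F G *m row_mx X Y = 1%:M.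
  by rewrite mul_col_row FX1 GY1 FY0 GX0 -scalar_mx_block.
by apply/eqP; rewrite eqn_leq (mulmx1_min QP) (mulmx1_min PQ).
Qed.

Lemma row_free_of_injective m n (M : 'M[K]_(m, n)) :
  (forall v : 'rV_m, v *m M = 0 -> v = 0) -> row_free M.
Proof.
move=> M_inj; rewrite -kermx_eq0; apply/eqP/row_matrixP => i; rewrite row0.
by apply: M_inj; apply/sub_kermxP; apply: row_sub.
Qed.

Lemma row_free_trmx_of_injective m n (M : 'M[K]_(m, n)) :
  (forall x : 'cV_n, M *m x = 0 -> x = 0) -> row_free M^T.
Proof.
move=> M_inj; apply: row_free_of_injective => v /(congr1 trmx).
rewrite trmx_mul trmxK trmx0 => /M_inj v0.
by apply: trmx_inj; rewrite v0 trmx0.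
Qed.

Lemma unitmx_of_injective m (M : 'M[K]_m) :
  (forall x : 'cV_m, M *m x = 0 -> x = 0) -> M \in unitmx.
Proof.
by move=> M_inj; rewrite -unitmx_tr -row_free_unit; apply: row_free_trmx_of_injective.
Qed.

Lemma nonzero_kernel a b (A : 'M[K]_(a, b)) : (a < b)%N ->
  exists2 x : 'cV[K]_b, x != 0 & A *m x = 0.
Proof.
move=> ab; have : kermx A^T != 0.
  rewrite -mxrank_eq0 mxrank_ker -lt0n subn_gt0.
  by apply: leq_ltn_trans ab; apply: rank_leq_col.
case/rowV0Pn => v vA v0; exists v^T; first by rewrite trmx_eq0.
by apply: trmx_inj; rewrite trmx_mul trmxK trmx0; apply/sub_kermxP.
Qed.

Lemma mulmx_col p q s (M : 'M[K]_(p, q)) (N : 'M_(q, s)) j :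
  M *m col j N = col j (M *m N).
Proof. by rewrite !colE mulmxA. Qed.

End LinearAlgebra.

(** * Equivalence and direct sums of pencils *)

Section Pencils.
Variable K : fieldType.

(** Bundling the dimensions lets direct sums be compared up to equivalence, so that
    no dimension has to be cast before the very end. *)
Record pencil := Pencil {
  prows : nat; pcols : nat;
  pA : 'M[K]_(prows, pcols); pB : 'M[K]_(prows, pcols) }.

(** Strict equivalence, in the form [P A = A' Q].  The transformations are rectangular
    with two-sided inverses because the two pencils have sizes that are equal but
    rarely convertible. *)
Definition pequiv (p q : pencil) : Prop :=
  exists (P : 'M[K]_(prows q, prows p)) (P' : 'M[K]_(prows p, prows q))
         (Q : 'M[K]_(pcols q, pcols p)) (Q' : 'M[K]_(pcols p, pcols q)),
    [/\ P *m P' = 1%:M /\ P' *m P = 1%:M, Q *m Q' = 1%:M /\ Q' *m Q = 1%:M,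
        P *m pA p = pA q *m Q & P *m pB p = pB q *m Q].

Definition psum (p q : pencil) : pencil :=
  Pencil (block_mx (pA p) 0 0 (pA q)) (block_mx (pB p) 0 0 (pB q)).

(** The substitution [lambda |-> lambda - a] in the parameter of the pencil
    [A - lambda B]. *)
Definition pshift (a : K) (p : pencil) : pencil :=
  Pencil (pA p + a *: pB p) (pB p).

Lemma pequiv_refl p : pequiv p p.
Proof. by exists 1%:M, 1%:M, 1%:M, 1%:M; rewrite !mul1mx !mulmx1. Qed.

Lemma pequiv_sym p q : pequiv p q -> pequiv q p.
Proof.
move=> [P [P' [Q [Q' [[PP' P'P] [QQ' Q'Q] eA eB]]]]].
exists P', P, Q', Q; split=> //.
  by rewrite -[P' *m _]mulmx1 -QQ' mulmxA -(mulmxA P') -eA !mulmxA P'P mul1mx.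
by rewrite -[P' *m _]mulmx1 -QQ' mulmxA -(mulmxA P') -eB !mulmxA P'P mul1mx.
Qed.

Lemma pequiv_trans q p s : pequiv p q -> pequiv q s -> pequiv p s.
Proof.
move=> [P [P' [Q [Q' [[PP' P'P] [QQ' Q'Q] eA eB]]]]].
move=> [S [S' [T [T' [[SS' S'S] [TT' T'T] fA fB]]]]].
exists (S *m P), (P' *m S'), (T *m Q), (Q' *m T'); split=> /=.
- by rewrite -!mulmxA (mulmxA P) PP' mul1mx SS' (mulmxA S') S'S mul1mx P'P.
- by rewrite -!mulmxA (mulmxA Q) QQ' mul1mx TT' (mulmxA T') T'T mul1mx Q'Q.
- by rewrite -mulmxA eA mulmxA fA -mulmxA.
- by rewrite -mulmxA eB mulmxA fB -mulmxA.
Qed.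

Lemma pequiv_psum p q p' q' : pequiv p p' -> pequiv q q' ->
  pequiv (psum p q) (psum p' q').
Proof.
move=> [P [P' [Q [Q' [[PP' P'P] [QQ' Q'Q] eA eB]]]]].
move=> [S [S' [T [T' [[SS' S'S] [TT' T'T] fA fB]]]]].
exists (block_mx P 0 0 S), (block_mx P' 0 0 S'),
       (block_mx Q 0 0 T), (block_mx Q' 0 0 T').
by split=> /=; rewrite !mulmx_block !(mulmx0, mul0mx, addr0, add0r)
  ?PP' ?P'P ?QQ' ?Q'Q ?SS' ?S'S ?TT' ?T'T -?scalar_mx_block ?eA ?eB ?fA ?fB.
Qed.

Lemma pequiv_pshift a p q : pequiv p q -> pequiv (pshift a p) (pshift a q).
Proof.
move=> [P [P' [Q [Q' [hP hQ eA eB]]]]]; exists P, P', Q, Q'; split=> //=.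
by rewrite mulmxDr mulmxDl -scalemxAr -scalemxAl eA eB.
Qed.

Lemma pshift_psum a p q : pshift a (psum p q) = psum (pshift a p) (pshift a q).
Proof.
by rewrite /pshift /psum /= scale_block_mx add_block_mx !scaler0 !addr0.
Qed.

Lemma pequiv_cast n m n' m' (A B : 'M[K]_(n, m)) (e : (n = n') * (m = m')) :
  pequiv (Pencil (castmx e A) (castmx e B)) (Pencil A B).
Proof. by case: e => e1 e2; subst; rewrite !castmx_id; exact: pequiv_refl. Qed.

Lemma psumA p q s : pequiv (psum p (psum q s)) (psum (psum p q) s).
Proof.
have H (X : 'M_(prows p, pcols p)) (Y : 'M_(prows q, pcols q)) (Z : 'M_(prows s, pcols s)) :
    block_mx X 0 0 (block_mx Y 0 0 Z) =
    castmx (esym (addnA _ _ _), esym (addnA _ _ _)) (block_mx (block_mx X 0 0 Y) 0 0 Z).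
  by have := @block_mxA _ _ _ _ _ _ _ X 0 0 0 Y 0 0 0 Z; rewrite /= !row_mx0 !col_mx0.
by rewrite /psum /= !H; apply: pequiv_cast.
Qed.

Lemma psum0 p : pequiv (psum p (Pencil (0 : 'M_(0, 0)) 0)) p.
Proof.
have e k : block_mx 1%:M 0 0 (0 : 'M[K]_0) = 1%:M :> 'M_(k + 0).
  by rewrite [RHS]scalar_mx_block (flatmx0 1%:M).
exists (row_mx 1%:M 0), (col_mx 1%:M 0), (row_mx 1%:M 0), (col_mx 1%:M 0).
by split=> /=; rewrite ?mul_row_block ?mul_row_col ?mul_col_row ?mul_mx_row
  !(mulmx0, mul0mx, mulmx1, mul1mx, addr0, e).
Qed.

Lemma psum0l p : pequiv (psum (Pencil (0 : 'M_(0, 0)) 0) p) p.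
Proof.
have e k : block_mx (0 : 'M[K]_0) 0 0 1%:M = 1%:M :> 'M_(0 + k).
  by rewrite [RHS]scalar_mx_block (flatmx0 1%:M).
exists (row_mx 0 1%:M), (col_mx 0 1%:M), (row_mx 0 1%:M), (col_mx 0 1%:M).
by split=> /=; rewrite ?mul_row_block ?mul_row_col ?mul_col_row ?mul_mx_row
  !(mulmx0, mul0mx, mulmx1, mul1mx, addr0, add0r, e).
Qed.

Definition kpencil (s : seq (kblock K)) : pencil :=
  Pencil (kdiag (@kb_A K) s) (kdiag (@kb_B K) s).

Definition kblock_pencil (b : kblock K) : pencil := Pencil (kb_A b) (kb_B b).

Lemma kpencil_cons b s : kpencil (b :: s) = psum (kblock_pencil b) (kpencil s).
Proof. by []. Qed.

Lemma kpencil1 b : pequiv (kpencil [:: b]) (kblock_pencil b).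
Proof. by rewrite kpencil_cons; apply: psum0. Qed.

Lemma kpencil_cat s1 s2 :
  pequiv (psum (kpencil s1) (kpencil s2)) (kpencil (s1 ++ s2)).
Proof.
elim: s1 => [|b s1 IH]; first exact: psum0l.
rewrite cat_cons !kpencil_cons.
apply: pequiv_trans (pequiv_sym (psumA _ _ _)) _.
by apply: pequiv_psum; [apply: pequiv_refl|apply: IH].
Qed.

Definition has_kcf (p : pencil) : Prop := exists s, pequiv p (kpencil s).

Lemma has_kcf_psum p q : has_kcf p -> has_kcf q -> has_kcf (psum p q).
Proof.
move=> [s1 e1] [s2 e2]; exists (s1 ++ s2).
by apply: pequiv_trans (kpencil_cat _ _); apply: pequiv_psum.
Qed.

Lemma has_kcf_equiv p q : pequiv p q -> has_kcf q -> has_kcf p.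
Proof. by move=> e [s e']; exists s; apply: pequiv_trans e'. Qed.

Lemma has_kcf_is_kcf n m (A B : 'M[K]_(n, m)) :
  has_kcf (Pencil A B) -> exists s, is_kcf A B s.
Proof.
move=> [s [P [P' [Q [Q' [/= [PP' P'P] [QQ' Q'Q] eA eB]]]]]]; exists s.
have en : kdiag_rows s = n.
  by apply/eqP; rewrite eqn_leq (mulmx1_min PP') (mulmx1_min P'P).
have em : kdiag_cols s = m.
  by apply/eqP; rewrite eqn_leq (mulmx1_min QQ') (mulmx1_min Q'Q).
subst n m.
exists P, Q', erefl, erefl; split.
- by case: (mulmx1_unit PP').
- by case: (mulmx1_unit QQ').
- by rewrite castmx_id eA -mulmxA QQ' mulmx1.
- by rewrite castmx_id eB -mulmxA QQ' mulmx1.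
Qed.

End Pencils.

(** * Nilpotent matrices and the Fitting decomposition *)

Section Jordan.
Variable K : fieldType.

Lemma intertwine_exp m p (N : 'M[K]_m) (M : 'M_p) (X : 'M_(m, p)) k :
  N *m X = X *m M -> N ^+ k *m X = X *m M ^+ k.
Proof.
move=> e; elim: k => [|k IH]; first by rewrite !expr0 mul1mx mulmx1.
by rewrite !exprS -!mulmxE -mulmxA IH mulmxA e mulmxA.
Qed.

Lemma jordan_block0_mul p q (M : 'M[K]_(p, q)) i j :
  (jordan_block p 0 *m M) i j =
  if insub i.+1 is Some i' then M i' j else 0.
Proof.
rewrite mxE; case: insubP => [i' _ ei'|ni].
  rewrite (bigD1 i') //= big1 ?addr0 => [|l nl]; rewrite !mxE.
    by rewrite ei' eqxx; case: eqP => [ii|_]; rewrite ?mul1r//; exfalso; move: ei'; rewrite -ii /=; lia.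
  case: eqP => [_|_]; rewrite ?mul0r// -ei'.
  by rewrite val_eqE eq_sym (negPf nl) mul0r.
rewrite big1 // => l _; rewrite !mxE; case: eqP => _; rewrite ?mul0r//.
by case: eqP => [e|_]; rewrite ?mul0r//; move: ni; rewrite e ltn_ord.
Qed.

Lemma mul_jordan_block0 p q (M : 'M[K]_(q, p)) i j :
  (M *m jordan_block p 0) i j =
  if insub j.-1 is Some j' then if (0 < j)%N then M i j' else 0 else 0.
Proof.
rewrite mxE; case: insubP => [j' _ ej'|]; last by rewrite -leqNgt; have := ltn_ord j; lia.
case: ifP => j0; last first.
  rewrite big1// => l _; rewrite !mxE; case: eqP => _; rewrite ?mulr0//.
  by case: eqP => [e|_]; rewrite ?mulr0//; lia.
rewrite (bigD1 j') //= big1 ?addr0 => [|l nl]; rewrite !mxE.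
  rewrite ej' prednK // eqxx; case: eqP => [ii|_]; rewrite ?mulr1//.
  by exfalso; move: ej'; rewrite ii /=; lia.
case: eqP => [_|_]; rewrite ?mulr0//.
case: eqP => [e|_]; rewrite ?mulr0//.
by case/eqP: nl; apply: val_inj => /=; rewrite ej' -e.
Qed.

(** If [p + 1] is the nilpotency index, some entry [(i, j)] of [N ^+ p] is nonzero.
    The chain generated by the [j]-th basis vector and the dual chain generated by
    the [i]-th coordinate form pair to a unitriangular matrix, so after normalization
    they are dual bases and the Jordan block splits off with an invariant complement. *)
Lemma split_nilpotent m (N : 'M[K]_m) k : (0 < m)%N -> N ^+ k = 0 ->
  exists p (X : 'M[K]_(m, p.+1)) (F : 'M[K]_(p.+1, m)),
    [/\ F *m X = 1%:M, N *m X = X *m jordan_block p.+1 0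
      & F *m N = jordan_block p.+1 0 *m F].
Proof.
move=> m0 Nk; have /ex_minnP [p /eqP Np pmin] : exists k, N ^+ k == 0 by exists k; apply/eqP.
case: p Np pmin => [/eqP|p Np pmin].
  by rewrite expr0 => /eqP/matrixP/(_ (Ordinal m0) (Ordinal m0)); rewrite !mxE eqxx => /eqP; rewrite oner_eq0.
have Nge l : (p < l)%N -> N ^+ l = 0 by move=> pl; rewrite -(subnK pl) exprD Np mulr0.
have /matrix0Pn [i [j Nij]] : N ^+ p != 0.
  by apply/negP => /pmin; rewrite ltnn.
(* The columns of X and the rows of F are listed so that both chains intertwine N
   with the same Jordan block. *)
pose X : 'M[K]_(m, p.+1) := \matrix_(a, c) ((N ^+ (p - c)) a j / (N ^+ p) i j).
pose F : 'M[K]_(p.+1, m) := \matrix_(c, b) (N ^+ c) i b.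
have NX : N *m X = X *m jordan_block p.+1 0.
  apply/matrixP => a c; rewrite mul_jordan_block0.
  have -> : (N *m X) a c = (N ^+ (p - c).+1) a j / (N ^+ p) i j.
    by rewrite exprS -mulmxE !mxE mulr_suml; apply: eq_bigr => l _; rewrite !mxE mulrA.
  case: insubP => [c' _ ec'|]; last by rewrite -leqNgt; have := ltn_ord c; lia.
  case: ifP => c0; first by rewrite mxE ec' (_ : p - c.-1 = (p - c).+1)%N //; have := ltn_ord c; lia.
  by rewrite Nge ?mxE ?mul0r//; lia.
have FN : F *m N = jordan_block p.+1 0 *m F.
  apply/matrixP => c b; rewrite jordan_block0_mul.
  have -> : (F *m N) c b = (N ^+ c.+1) i b.
    by rewrite exprSr -mulmxE !mxE; apply: eq_bigr => l _; rewrite !mxE.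
  case: insubP => [c' _ ec'|]; first by rewrite mxE ec'.
  by rewrite -leqNgt => pc; rewrite Nge ?mxE//; lia.
have FXe c d : (F *m X) c d = (N ^+ (c + (p - d))) i j / (N ^+ p) i j.
  by rewrite exprD -mulmxE !mxE mulr_suml; apply: eq_bigr => l _; rewrite !mxE mulrA.
have FXu : F *m X \in unitmx.
  rewrite -unitmx_tr unitmxE det_trig; last first.
    apply/is_trig_mxP => c d cd; rewrite mxE FXe Nge ?mxE ?mul0r//.
    by have := ltn_ord d; lia.
  rewrite big1 ?unitr1// => c _; rewrite mxE FXe subnKC ?divff//.
  by have := ltn_ord c; lia.
(* The pairing F X commutes with the Jordan block, hence F can be normalized. *)
have TJ : F *m X *m jordan_block p.+1 0 = jordan_block p.+1 0 *m (F *m X).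
  by rewrite mulmxA -FN -!mulmxA NX.
exists p, X, (invmx (F *m X) *m F); split=> //.
  by rewrite -mulmxA mulVmx.
rewrite -mulmxA FN !mulmxA; congr (_ *m F).
move: (F *m X) FXu TJ => T Tu TJ.
by rewrite -[LHS](mulmxK Tu) -(mulmxA (invmx T)) -TJ (mulmxA (invmx T)) mulVmx// mul1mx.
Qed.

(** The Jordan form of a nilpotent matrix as an induction principle: it is used for
    pencils [(N + a, 1)] and for pencils [(1, N)]. *)
Lemma nilpotent_ind (P : forall m, 'M[K]_m -> Prop) :
  P 0%N 0 ->
  (forall p m (M : 'M_m), P m M -> P (p.+1 + m)%N (block_mx (jordan_block p.+1 0) 0 0 M)) ->
  (forall m m' (N : 'M_m) (M : 'M_m') S S', S *m S' = 1%:M -> S' *m S = 1%:M ->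
     N *m S = S *m M -> P m' M -> P m N) ->
  forall m (N : 'M_m) k, N ^+ k = 0 -> P m N.
Proof.
move=> P0 PJ PS m; have [n] := ubnP m; elim: n m => // n IH [|m] ltmn N k Nk.
  by rewrite [N]flatmx0.
have [p [X [F [FX NX FN]]]] := split_nilpotent (ltn0Sn m) Nk.
have [q [Y [G [GY FY GX XFYG pq]]]] := split_complement FX.
have NY : N *m Y = Y *m (G *m N *m Y).
  rewrite -[LHS]mul1mx -XFYG mulmxDl -!mulmxA (mulmxA F) FN -(mulmxA _ F) FY.
  by rewrite !mulmx0 add0r.
have GNX : G *m (N *m X) = 0 by rewrite NX mulmxA GX mul0mx.
have FNY : F *m (N *m Y) = 0 by rewrite NY mulmxA FY mul0mx.
apply: (PS _ _ N (block_mx (jordan_block p.+1 0) 0 0 (G *m N *m Y)) (row_mx X Y) (col_mx F G)).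
- by rewrite mul_row_col.
- by rewrite mul_col_row FX FY GX GY -scalar_mx_block.
- by rewrite mul_mx_row mul_row_block !mulmx0 addr0 add0r NX -NY.
apply: PJ; apply: (IH q _ _ k); first lia.
by rewrite -[LHS]mul1mx -GY -mulmxA -(intertwine_exp k NY) Nk mul0mx mulmx0.
Qed.

(** Replacing [k] by [2 k] as long as the rank of [N ^+ k] drops must stop. *)
Lemma stable_rank m (N : 'M[K]_m) : exists2 k, (0 < k)%N &
  \rank (N ^+ k *m N ^+ k) = \rank (N ^+ k).
Proof.
suff H b k : (0 < k)%N -> (\rank (N ^+ k) < b)%N -> exists2 k, (0 < k)%N &
  \rank (N ^+ k *m N ^+ k) = \rank (N ^+ k).
  by apply: (H (\rank (N ^+ 1)).+1 1%N).
elim: b k => // b IH k k0 lb.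
have := mxrankM_maxl (N ^+ k) (N ^+ k); rewrite leq_eqVlt => /orP [/eqP e|lt].
  by exists k.
by apply: (IH (k + k)%N); [lia|rewrite exprD -mulmxE; lia].
Qed.

(** For a power [M] of [N] with [rank (M ^ 2) = rank M], the space is the direct sum of
    the image and the kernel of [M]; on the image [N] is invertible, on the kernel it
    is nilpotent. *)
Lemma fitting m (N : 'M[K]_m) :
  exists p q (X : 'M[K]_(m, p)) (F : 'M[K]_(p, m)) (Y : 'M[K]_(m, q)) (G : 'M[K]_(q, m))
    (N1 : 'M_p) (N2 : 'M_q) k,
    [/\ row_mx X Y *m col_mx F G = 1%:M, col_mx F G *m row_mx X Y = 1%:M,
        N *m row_mx X Y = row_mx X Y *m block_mx N1 0 0 N2 &
        N1 \in unitmx /\ N2 ^+ k = 0].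
Proof.
have [k k0] := stable_rank N.
set M := N ^+ k => rM.
have [Y' Y'Y] := row_fullP (col_base_full M).
have [G' GG'] := row_freeP (row_base_free M).
move: (mulmx_base M) Y' G' Y'Y GG' rM.
move: (\rank M) (col_base M) (row_base M) => p Y G YG Y' G' Y'Y GG' rM.
have GYu : G *m Y \in unitmx.
  rewrite -row_full_unit -col_leq_rank -[X in (X <= _)%N]rM -YG.
  rewrite -!mulmxA (mulmxA G Y G) mulmxA.
  apply: leq_trans (mxrankM_maxl _ _) _; exact: mxrankM_maxr.
have [F [T [FT FY GYF]]] : exists F T, [/\ F = T *m G, F *m Y = 1%:M & G *m Y *m F = G].
  exists (invmx (G *m Y) *m G), (invmx (G *m Y)).
  by split=> //; [rewrite -mulmxA mulVmx|rewrite mulKVmx].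
have [q [Z [H [HZ FZ HY YFZH _]]]] := split_complement FY.
have NM : N *m M = M *m N by rewrite /M mulmxE -exprS -exprSr.
have YFM : Y *m F *m M = M.
  by rewrite -YG mulmxA -(mulmxA Y F Y) FY mulmx1.
have MZ : M *m Z = 0.
  by rewrite -YG -GYF mulmxA -mulmxA FZ mulmx0.
have HM : H *m M = 0 by rewrite -YG mulmxA HY mul0mx.
have HNY : H *m N *m Y = 0.
  by apply: (mulmx_right_inj GG'); rewrite -mulmxA YG -mulmxA NM mulmxA HM !mul0mx.
have FNZ : F *m N *m Z = 0.
  have : G *m N *m Z = 0.
    apply: (mulmx_left_inj Y'Y).
    by rewrite mulmx0 !mulmxA YG -NM -mulmxA MZ mulmx0.
  by rewrite FT -!mulmxA => ->; rewrite mulmx0.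
have NY : N *m Y = Y *m (F *m N *m Y).
  by rewrite -[LHS]mul1mx -YFZH mulmxDl -!mulmxA (mulmxA H) HNY mulmx0 addr0.
have NZ : N *m Z = Z *m (H *m N *m Z).
  by rewrite -[LHS]mul1mx -YFZH mulmxDl -!mulmxA (mulmxA F) FNZ mulmx0 add0r.
exists p, q, Y, F, Z, H, (F *m N *m Y), (H *m N *m Z), k; split.
- by rewrite mul_row_col.
- by rewrite mul_col_row FY FZ HY HZ -scalar_mx_block.
- by rewrite mul_mx_row mul_row_block !mulmx0 addr0 add0r -NY -NZ.
split; last first.
  by rewrite -[LHS]mul1mx -HZ -mulmxA -(intertwine_exp k NZ) -/M MZ mulmx0.
have : (F *m N *m Y) ^+ k \in unitmx.
  rewrite -[X in X \in _]mul1mx -FY -mulmxA -(intertwine_exp k NY) -/M.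
  by rewrite -YG -!mulmxA (mulmxA F) FY mul1mx.
case: k k0 {rM M YG YFM MZ HM NM} => // k _.
by rewrite exprS -mulmxE unitmx_mul => /andP [].
Qed.
End Jordan.

(** * Square pencils *)

Section Square.
Variable K : numClosedFieldType.

Lemma pequiv_bases n m n' m' (A B : 'M[K]_(n, m)) (A' B' : 'M[K]_(n', m')) S S' T T' :
  S *m S' = 1%:M -> S' *m S = 1%:M -> T *m T' = 1%:M -> T' *m T = 1%:M ->
  A *m T = S *m A' -> B *m T = S *m B' -> pequiv (Pencil A B) (Pencil A' B').
Proof. by move=> *; apply: pequiv_sym; exists S, S', T, T'. Qed.

Lemma jordan_block_shift p (a : K) : jordan_block p 0 + a%:M = jordan_block p a.
Proof.
apply/matrixP => i j; rewrite !mxE; by case: eqP => _; rewrite ?add0r ?addr0.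
Qed.

Lemma has_kcf_nilpotent_shift a m (N : 'M[K]_m) k : N ^+ k = 0 ->
  has_kcf (Pencil (N + a%:M) 1%:M).
Proof.
move: m N k; apply: nilpotent_ind => [|p m M IH|m m' N M S S' SS' S'S e].
- by exists [::]; rewrite [_ + _]flatmx0 (flatmx0 1%:M); apply: pequiv_refl.
- have -> : Pencil (block_mx (jordan_block p.+1 0) 0 0 M + a%:M) 1%:M =
      psum (kblock_pencil (KFinite p a)) (Pencil (M + a%:M) 1%:M).
    rewrite /psum /= !scalar_mx_block add_block_mx !addr0; congr (Pencil (block_mx _ _ _ _) _).
    exact: jordan_block_shift.
  apply: has_kcf_psum => //; exists [:: KFinite p a].
  exact/pequiv_sym/kpencil1.
- apply: has_kcf_equiv.
  apply: (pequiv_bases SS' S'S SS' S'S); last by rewrite mul1mx mulmx1.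
  by rewrite mulmxDl mulmxDr e scalar_mxC.
Qed.

Lemma has_kcf_nilpotent_infinite m (N : 'M[K]_m) k : N ^+ k = 0 ->
  has_kcf (Pencil 1%:M N).
Proof.
move: m N k; apply: nilpotent_ind => [|p m M IH|m m' N M S S' SS' S'S e].
- by exists [::]; rewrite (flatmx0 1%:M); apply: pequiv_refl.
- have -> : Pencil 1%:M (block_mx (jordan_block p.+1 0) 0 0 M) =
      psum (kblock_pencil (KInfinite K p)) (Pencil 1%:M M).
    by rewrite /psum /= scalar_mx_block.
  apply: has_kcf_psum => //; exists [:: KInfinite K p].
  exact/pequiv_sym/kpencil1.
- apply: has_kcf_equiv.
  by apply: (pequiv_bases SS' S'S SS' S'S); rewrite ?mul1mx ?mulmx1.
Qed.

(** Induction on the size: the Fitting decomposition of [X - a], for an eigenvalue [a],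
    splits off a nonzero part on which [X - a] is nilpotent. *)
Lemma has_kcf_matrix m (X : 'M[K]_m) : has_kcf (Pencil X 1%:M).
Proof.
have [n] := ubnP m; elim: n m X => // n IH [|m] X ltmn.
  by exists [::]; rewrite [X]flatmx0 (flatmx0 1%:M); apply: pequiv_refl.
have [a /eigenvalueP [v vX v0]] := eigenvalue_closed X (ltn0Sn m).
have [p [q [Y [F [Z [G [N1 [N2 [k [e1 e2 e3 [N1u N2k]]]]]]]]]]] := fitting (X - a%:M).
have eX : X *m row_mx Y Z = row_mx Y Z *m block_mx (N1 + a%:M) 0 0 (N2 + a%:M).
  have -> : block_mx (N1 + a%:M) 0 0 (N2 + a%:M) = block_mx N1 0 0 N2 + a%:M.
    by rewrite scalar_mx_block add_block_mx !addr0.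
  rewrite mulmxDr -e3 -[X in X *m _](subrK a%:M) (mulmxDl (X - _)).
  by congr (_ + _); rewrite scalar_mxC.
have q0 : (0 < q)%N.
  rewrite lt0n; apply/eqP => q0; subst q.
  have : X - a%:M \in unitmx.
    have -> : X - a%:M = row_mx Y Z *m block_mx N1 0 0 N2 *m col_mx F G.
      by rewrite -e3 -mulmxA e1 mulmx1.
    rewrite (flatmx0 N2) [Z]thinmx0 [G]flatmx0 mul_row_block !(mulmx0, addr0).
    rewrite mul_row_col !(mulmx0, mul0mx, addr0).
    have [] : (p <= m.+1)%N /\ (m.+1 <= p)%N.
      by have := mulmx1_min e1; have := mulmx1_min e2; lia.
    move=> h1 h2; have ep : p = m.+1 by lia.
    subst p; rewrite !unitmx_mul N1u.
    move: e1; rewrite [Z]thinmx0 [G]flatmx0 mul_row_col !(mulmx0, mul0mx, addr0) => /mulmx1_unit [-> ->].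
    by [].
  move=> u; case/eqP: v0.
  by rewrite -[v](mulmxK u) mulmxBr vX mul_mx_scalar subrr mul0mx.
have pq : (p + q <= m.+1)%N := mulmx1_min e2.
apply: (@has_kcf_equiv _ _ (psum (Pencil (N1 + a%:M) 1%:M) (Pencil (N2 + a%:M) 1%:M))).
  apply: (pequiv_bases e1 e2 e1 e2) => //=.
  by rewrite mul1mx -scalar_mx_block mulmx1.
apply: has_kcf_psum; first by apply: IH; lia.
exact: has_kcf_nilpotent_shift N2k.
Qed.

Lemma nilpotent_unit m (N : 'M[K]_m) k : N ^+ k = 0 -> 1%:M + N \in unitmx.
Proof.
move=> Nk; have /(congr1 -%R) := subrX1 (- N) k.
rewrite exprNn Nk mulr0 sub0r opprK -mulNr opprB opprK -mulmxE => /esym h.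
by case: (mulmx1_unit h).
Qed.

(** Decompose [M] into an invertible and a nilpotent part.  Where [M] is invertible,
    [(1 + a M, M)] is equivalent to [(M^-1 + a, 1)] and only has finite eigenvalues;
    where it is nilpotent, [1 + a M] is invertible and only the infinite eigenvalue
    occurs. *)
Lemma has_kcf_shift_id a m (M : 'M[K]_m) : has_kcf (pshift a (Pencil 1%:M M)).
Proof.
have [p [q [Y [F [Z [G [M1 [M2 [k [e1 e2 e3 [M1u M2k]]]]]]]]]]] := fitting M.
apply: (@has_kcf_equiv _ _ (psum (pshift a (Pencil 1%:M M1)) (pshift a (Pencil 1%:M M2)))).
  rewrite -pshift_psum; apply: pequiv_pshift.
  apply: (pequiv_bases e1 e2 e1 e2) => //=.
  by rewrite mul1mx -scalar_mx_block mulmx1.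
apply: has_kcf_psum.
  apply: has_kcf_equiv (has_kcf_matrix (invmx M1 + a%:M)).
  apply: (@pequiv_bases _ _ _ _ _ _ _ _ M1 (invmx M1) 1%:M 1%:M) => //=;
    rewrite ?mulmxV ?mulVmx ?mulmx1//.
  by rewrite mulmxDr mulmxV// mul_mx_scalar.
set T := 1%:M + a *: M2.
have aM2 : (a *: M2) ^+ k = 0.
  rewrite -mul_scalar_mx mulmxE exprMn_comm ?M2k ?mulr0//.
  by rewrite /GRing.comm -mulmxE scalar_mxC.
have Tu : T \in unitmx := nilpotent_unit aM2.
have TM2 : GRing.comm (invmx T) M2.
  rewrite /GRing.comm -!mulmxE.
  have c : T *m M2 = M2 *m T by rewrite /T mulmxDl mulmxDr mul1mx mulmx1 -scalemxAl -scalemxAr.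
  by rewrite -[LHS](mulmxK Tu) -(mulmxA (invmx T)) -c (mulmxA (invmx T)) mulVmx// mul1mx.
have nil : (invmx T *m M2) ^+ k = 0 by rewrite mulmxE exprMn_comm// M2k mulr0.
apply: has_kcf_equiv (has_kcf_nilpotent_infinite nil).
apply: (@pequiv_bases _ _ _ _ _ _ _ _ T (invmx T) 1%:M 1%:M) => //=;
  rewrite ?mulmxV ?mulVmx ?mulmx1 ?mulKVmx//.
Qed.

End Square.

(** * The extension of a pencil with injective first matrix *)

Section LeftBlocks.
Variable K : fieldType.

(** The columns of [E] span a complement of the image of the injective matrix [A]. *)
Definition is_complement n m c (A : 'M[K]_(n, m)) (E : 'M[K]_(n, c)) : Prop :=
  exists (U : 'M_(m, n)) (V : 'M_(c, n)),
    [/\ U *m A = 1%:M, V *m A = 0, U *m E = 0, V *m E = 1%:M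
      & A *m U + E *m V = 1%:M].

(** Each basis vector of the complement becomes a new vector of the domain, which [A]
    sends to that basis vector and [B] sends to a new vector of the codomain.  A left
    singular block of size [p] is thereby prolonged to size [p + 1], and a square
    pencil with [A = 1] is unchanged. *)
Definition pext (p : pencil K) c (E : 'M[K]_(prows p, c)) : pencil K :=
  Pencil (block_mx (pA p) E 0 0) (block_mx (pB p) 0 0 1%:M).

(** The extension does not depend on the complement: a change of complement alters [A]
    by columns in the image of [A], and the resulting entries of [B] are cleared with
    the new identity block. *)
Lemma pequiv_pext p q c d (E : 'M_(prows p, c)) (E' : 'M_(prows q, d)) :
  pequiv p q -> is_complement (pA p) E -> is_complement (pA q) E' ->
  pequiv (pext E) (pext E').
Proof.
case: p E => n m A B /= E; case: q E' => n' m' A' B' /= E'.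
move=> [P [P' [Q [Q' [/= [PP' P'P] [QQ' Q'Q] eA eB]]]]].
move=> [U [V [UA VA UE VE AUEV]]] [U' [V' [UA' VA' UE' VE' AUEV']]].
pose X := U' *m P *m E; pose Y := V' *m P *m E; pose Y' := V *m P' *m E'.
have eA' : A *m Q' = P' *m A'.
  by rewrite -[LHS]mul1mx -P'P -!mulmxA (mulmxA P) eA -!mulmxA QQ' mulmx1.
have PE : P *m E = A' *m X + E' *m Y.
  by rewrite -[LHS]mul1mx -AUEV' mulmxDl /X /Y !mulmxA.
have PE' : P' *m E' = A *m (U *m P' *m E') + E *m Y'.
  by rewrite -[LHS]mul1mx -AUEV mulmxDl /Y' !mulmxA.
have YY' : Y *m Y' = 1%:M.
  have -> : Y *m Y' = V' *m P *m (E *m Y') by exact/esym/mulmxA.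
  have -> : E *m Y' = P' *m E' - A *m (U *m P' *m E') by rewrite PE' addrC addKr.
  rewrite mulmxBr -!mulmxA (mulmxA P) PP' mul1mx VE' (mulmxA P) eA.
  by rewrite !mulmxA VA' !mul0mx subr0.
have Y'Y : Y' *m Y = 1%:M.
  have -> : Y' *m Y = V *m P' *m (E' *m Y) by exact/esym/mulmxA.
  have -> : E' *m Y = P *m E - A' *m X by rewrite PE addrC addKr.
  rewrite mulmxBr -!mulmxA (mulmxA P') P'P mul1mx VE (mulmxA P') -eA'.
  by rewrite !mulmxA VA !mul0mx subr0.
clearbody X Y Y'.
exists (block_mx P (B' *m X) 0 Y), (block_mx P' (- (P' *m (B' *m X) *m Y')) 0 Y').
exists (block_mx Q X 0 Y), (block_mx Q' (- (Q' *m X *m Y')) 0 Y').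
split=> /=.
- split; rewrite mulmx_block !(mulmx0, mul0mx, addr0, add0r) ?YY' ?Y'Y ?PP' ?P'P scalar_mx_block //.
    by congr (block_mx _ _ _ _); rewrite mulmxN !mulmxA PP' mul1mx addNr.
  by congr (block_mx _ _ _ _); rewrite mulNmx -!mulmxA Y'Y mulmx1 subrr.
- split; rewrite mulmx_block !(mulmx0, mul0mx, addr0, add0r) ?YY' ?Y'Y ?QQ' ?Q'Q scalar_mx_block //.
    by congr (block_mx _ _ _ _); rewrite mulmxN !mulmxA QQ' mul1mx addNr.
  by congr (block_mx _ _ _ _); rewrite mulNmx -!mulmxA Y'Y mulmx1 subrr.
- by rewrite !mulmx_block !(mulmx0, mul0mx, addr0, add0r) eA PE.
- by rewrite !mulmx_block !(mulmx0, mul0mx, mulmx1, mul1mx, addr0, add0r) eB.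
Qed.

Lemma is_complement_psum n m c n' m' c' (A : 'M_(n, m)) (E : 'M_(n, c))
   (A' : 'M_(n', m')) (E' : 'M_(n', c')) :
  is_complement A E -> is_complement A' E' ->
  is_complement (block_mx A 0 0 A') (block_mx E 0 0 E').
Proof.
move=> [U [V [h1 h2 h3 h4 h5]]] [U' [V' [h1' h2' h3' h4' h5']]].
exists (block_mx U 0 0 U'), (block_mx V 0 0 V').
split; rewrite !mulmx_block !(mulmx0, mul0mx, addr0, add0r)
  ?h1 ?h2 ?h3 ?h4 ?h1' ?h2' ?h3' ?h4' -?scalar_mx_block ?block_mx0 //.
by rewrite add_block_mx !addr0 h5 h5' -scalar_mx_block.
Qed.

(** Both sides are conjugate by the permutation of the four blocks. *)
Lemma pext_psum p q c d (E : 'M_(prows p, c)) (E' : 'M_(prows q, d)) :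
  pequiv (@pext (psum p q) _ (block_mx E 0 0 E')) (psum (pext E) (pext E')).
Proof.
pose T a b u v : 'M[K]_((a + u) + (b + v), (a + b) + (u + v)) :=
  block_mx (block_mx 1%:M 0 0 0) (block_mx 0 0 1%:M 0)
           (block_mx 0 1%:M 0 0) (block_mx 0 0 0 1%:M).
have TT a b u v : T a b u v *m T a u b v = 1%:M.
  rewrite /T !mulmx_block !(mulmx0, mul0mx, mulmx1, mul1mx, addr0, add0r).
  by rewrite !add_block_mx !(addr0, add0r) -!scalar_mx_block !block_mx0 -scalar_mx_block.
exists (T _ _ _ _), (T _ _ _ _), (T _ _ _ _), (T _ _ _ _); split=> /=.
- by rewrite !TT.
- by rewrite !TT.
- rewrite /T !mulmx_block !(mulmx0, mul0mx, mulmx1, mul1mx, addr0, add0r).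
  by rewrite ?add_block_mx ?(addr0, add0r) ?block_mx0.
- rewrite /T scalar_mx_block !mulmx_block !(mulmx0, mul0mx, mulmx1, mul1mx, addr0, add0r).
  by rewrite ?add_block_mx ?(addr0, add0r) ?block_mx0.
Qed.

Lemma kFE p : kF K p = rowsub (widen_ord (leqnSn p)) 1%:M.
Proof. by apply/matrixP => i j; rewrite !mxE. Qed.

Lemma kGE p : kG K p = rowsub (lift ord0) 1%:M.
Proof. by apply/matrixP => i j; rewrite !mxE. Qed.

Lemma pext_left_block p : exists E : 'M_(p.+1, 1),
  is_complement (kF K p)^T E /\
  pequiv (@pext (kblock_pencil (KLeft K p)) _ E) (kblock_pencil (KLeft K p.+1)).
Proof.
pose E : 'M[K]_(p.+1, 1) := \col_i (i == p :> nat)%:R.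
exists E; split.
  exists (kF K p), E^T; split.
  - rewrite [X in X *m _]kFE mul_rowsub_mx mul1mx; apply/matrixP => i j; rewrite !mxE /=.
    by rewrite eq_sym.
  - apply: trmx_inj; rewrite trmx_mul trmxK [X in X *m _]kFE mul_rowsub_mx mul1mx.
    by apply/matrixP => i j; rewrite !mxE/=; have := ltn_ord i; case: eqP => //; lia.
  - rewrite [X in X *m _]kFE mul_rowsub_mx mul1mx.
    by apply/matrixP => i j; rewrite !mxE/=; have := ltn_ord i; case: eqP => //; lia.
  - apply/matrixP => i j; rewrite !ord1 !mxE (bigD1 ord_max)//= !mxE eqxx mulr1.
    rewrite big1 ?addr0// => k nk; rewrite !mxE; case: eqP => // e; last by rewrite mul0r.
    by case/eqP: nk; apply: val_inj.
  - apply/matrixP => i j; rewrite !mxE big_ord1 !mxE.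
    under eq_bigr => k _ do rewrite !mxE.
    have [ip|pi] := ltnP i p.
      rewrite (bigD1 (Ordinal ip)) //= eqxx mul1r big1 => [|k nk].
        by rewrite addr0 (ltn_eqF ip) mul0r addr0.
      by case: eqP => e; rewrite ?mul0r//; case/eqP: nk; apply: val_inj.
    have ei : i = p :> nat by have := ltn_ord i; lia.
    rewrite big1 => [|k _]; last first.
      by case: eqP => e; rewrite ?mul0r//; have := ltn_ord k; lia.
    by rewrite ei eqxx mul1r add0r -val_eqE /= ei eq_sym.
rewrite /pext /=.
have -> : kblock_pencil (KLeft K p.+1) =
  Pencil (castmx (addn1 _, addn1 _) (block_mx (kF K p)^T E 0 0))
         (castmx (addn1 _, addn1 _) (block_mx (kG K p)^T 0 0 1%:M)).
  congr Pencil; apply/matrixP => i j; rewrite castmxE !mxE.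
  - case: splitP => k /= ek; rewrite mxE; case: splitP => l /= el; rewrite !mxE ?ek ?el //=.
    + by rewrite (ord1 l) /= addn0 eq_sym.
    + by rewrite eq_sym (ord1 k) /= addn0; have := ltn_ord l; case: eqP => // <-; rewrite ltnNge leqnSn.
    + by rewrite (ord1 k) (ord1 l) /= !addn0 eqn_leq ltnn andbF.
  - case: splitP => k /= ek; rewrite mxE; case: splitP => l /= el; rewrite !mxE ?ek ?el //=.
    + by have := ltn_ord k; case: eqP => // <-; rewrite ltnS ltnNge leq_addr.
    + by rewrite (ord1 k) /= addn0; have := ltn_ord l; case: eqP => // [[->]]; rewrite ltnn.
    + by rewrite !ord1 /= !addn0 !eqxx.
exact/pequiv_sym/pequiv_cast.
Qed.
End LeftBlocks.

(** * Pencils A - lambda B with A injective *)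

Section InjectivePencils.
Variable K : fieldType.

Definition lpencil (ps : seq nat) : pencil K := kpencil [seq KLeft K p | p <- ps].

Lemma lpencil_cat s1 s2 : pequiv (psum (lpencil s1) (lpencil s2)) (lpencil (s1 ++ s2)).
Proof. by rewrite /lpencil map_cat; apply: kpencil_cat. Qed.

Lemma pext_lpencil ps : exists c (E : 'M_(prows (lpencil ps), c)),
  is_complement (pA (lpencil ps)) E /\ pequiv (pext E) (lpencil (map S ps)).
Proof.
elim: ps => [|p ps [c [E [cE eE]]]].
  exists 0%N, 0; split.
    by exists 0, 0; split; apply/matrixP => - [].
  rewrite /pext /=.
  exists 0, 0, 0, 0; do !split; by apply/matrixP => - [].
have [F [cF eF]] := pext_left_block K p.
exists (1 + c)%N, (block_mx F 0 0 E); split; first exact: (is_complement_psum cF cE).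
apply: (@pequiv_trans _ (psum (pext (p := kblock_pencil (KLeft K p)) F) (pext E))).
  exact: (@pext_psum _ (kblock_pencil (KLeft K p))).
exact: (pequiv_psum eF eE).
Qed.

Lemma pext_square q (M : 'M[K]_q) :
  is_complement (1%:M : 'M[K]_q) (0 : 'M[K]_(q, 0)) /\
  pequiv (@pext K (Pencil 1%:M M) 0 0) (Pencil 1%:M M).
Proof.
split.
  by exists 1%:M, 0; split; rewrite ?mul1mx ?mul0mx ?addr0 //; apply/matrixP => - [].
rewrite /pext /= (flatmx0 (1%:M : 'M_0)).
exact: (@psum0 _ (Pencil 1%:M M)).
Qed.

Lemma lpencil0 d : pequiv (Pencil (0 : 'M_(d, 0)) 0) (lpencil (nseq d 0%N)).
Proof.
have e : prows (lpencil (nseq d 0)) = d /\ pcols (lpencil (nseq d 0)) = 0%N.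
  by rewrite /lpencil; elim: d => //= d [] /= -> ->.
case: (lpencil _) e => n m A B /= [en em]; subst n m.
by rewrite (thinmx0 A) (thinmx0 B); apply: pequiv_refl.
Qed.

(** View [A] as an inclusion of the domain in the codomain and restrict the pencil to the
    subspace of the vectors that [B] maps into the image of [A].  The restricted pencil
    goes from this subspace to the old domain, hence has fewer rows unless [A] is square,
    and its first matrix is again injective.  The original pencil is its extension plus
    zero rows, which are left singular blocks of size 0. *)
Theorem injective_pencil_form n m (A B : 'M[K]_(n, m)) (L : 'M_(m, n)) :
  L *m A = 1%:M ->
  exists q (M : 'M_q) ps, pequiv (Pencil A B) (psum (Pencil 1%:M M) (lpencil ps)).
Proof.
have [N] := ubnP n; elim: N n m A B L => // N IH n m A B L ltnN LA.
have [c [Ac [G [GAc LAc GA ALAG mc]]]] := split_complement LA.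
have [c0|c0] := posnP c.
  subst c; have e1 : A *m L = 1%:M by rewrite -ALAG (thinmx0 Ac) mul0mx addr0.
  exists m, (L *m B), [::]; apply: pequiv_trans (pequiv_sym (psum0 _)).
  exists L, A, 1%:M, 1%:M; split=> //=; rewrite ?mulmx1 ?mul1mx //.
set B2 := G *m B.
have [Cl ClCb] := row_fullP (col_base_full B2).
have [H RbH] := row_freeP (row_base_free B2).
move: (mulmx_base B2) Cl H ClCb RbH.
move: (\rank B2) (col_base B2) (row_base B2) => rho Cb Rb CR Cl H ClCb RbH.
have [m1 [Kb [K' [K'K RbK K'H HRb _]]]] := split_complement RbH.
have [d [Cd [Cdl [CdlCd ClCd CdlCb CbCl _]]]] := split_complement ClCb.
have B2K : B2 *m Kb = 0 by rewrite -CR -mulmxA RbK mulmx0.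
have B2H : B2 *m H = Cb by rewrite -CR -mulmxA RbH mulmx1.
have ltm : (m < N)%N by lia.
have [q [M [ps e]]] := IH m m1 Kb (L *m B *m Kb) K' ltm K'K.
exists q, M, (map S ps ++ nseq d 0%N).
have compK : is_complement Kb H.
  by exists K', Rb; split=> //; rewrite addrC.
(* W clears the block of L B on the vectors that B maps outside the image of A. *)
pose W := - (L *m B *m H *m Cl).
have step1 : pequiv (Pencil A B)
    (psum (@pext _ (Pencil Kb (L *m B *m Kb)) _ H) (Pencil (0 : 'M_(d, 0)) 0)).
  have LWB : (L + W *m G) *m B *m H = 0.
    rewrite mulmxDl -(mulmxA W) -/B2 mulmxDl -(mulmxA W) B2H /W mulNmx.
    by rewrite -(mulmxA _ Cl) ClCb mulmx1 subrr.
  have LWK : (L + W *m G) *m B *m Kb = L *m B *m Kb.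
    by rewrite mulmxDl -(mulmxA W) -/B2 mulmxDl -(mulmxA W) B2K mulmx0 addr0.
  have LWA : (L + W *m G) *m A = 1%:M by rewrite mulmxDl -mulmxA GA mulmx0 addr0.
  have eT : A *m (L + W *m G) + (Ac - A *m W) *m G = 1%:M.
    by rewrite mulmxDr mulmxBl !mulmxA addrACA subrr addr0.
  have LWT : (L + W *m G) *m (Ac - A *m W) = 0.
    by rewrite mulmxBr (mulmxA _ A) LWA mul1mx mulmxDl LAc -mulmxA GAc mulmx1 add0r subrr.
  have GT : G *m (Ac - A *m W) = 1%:M by rewrite mulmxBr GAc mulmxA GA mul0mx subr0.
  move: (L + W *m G) (Ac - A *m W) LWB LWK LWA eT LWT GT => L' T LWB LWK LWA eT LWT GT.
  have BHK : B *m row_mx Kb H = row_mx (B *m Kb) (B *m H) by rewrite mul_mx_row.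
  have QQ : row_mx Kb H *m col_mx K' Rb = 1%:M by rewrite mul_row_col addrC.
  apply: pequiv_sym.
  exists (row_mx (row_mx A (T *m Cb)) (T *m Cd)), (col_mx (col_mx L' (Cl *m G)) (Cdl *m G)).
  exists (row_mx (row_mx Kb H) 0), (col_mx (col_mx K' Rb) 0).
  split; rewrite /=.
  - rewrite !mul_row_col !mul_col_row !mul_mx_row !mul_col_mx -!(mulmxA _ G) !(mulmxA G) GT GA LWA (mulmxA L') LWT.
    rewrite !(mulmx0, mul0mx, mul1mx) (mulmxA L') LWT mul0mx ClCb CdlCd ClCd CdlCb; split; last first.
      by rewrite row_mx0 col_mx0 -!scalar_mx_block.
    by rewrite -addrA -!(mulmxA T) -mulmxDr !(mulmxA _ _ G) -mulmxDl CbCl mul1mx.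
  - rewrite !mul_row_col mul0mx addr0 addrC HRb; split=> //.
    rewrite !mul_col_row mulmx0 K'K K'H RbK RbH -scalar_mx_block mulmx0 !mul0mx.
    by rewrite [RHS]scalar_mx_block (flatmx0 (1%:M : 'M_0)).
  - by rewrite mul_row_block !mul_mx_row mul_row_block !(mulmx0, addr0).
  - have BK : B *m Kb = A *m (L *m B *m Kb).
      by rewrite -[LHS]mul1mx -eT mulmxDl -!mulmxA (mulmxA G) B2K mulmx0 addr0 (mulmxA L') LWK -mulmxA.
    have BH : B *m H = T *m Cb.
      by rewrite -[LHS]mul1mx -eT mulmxDl -!mulmxA (mulmxA G) B2H (mulmxA L') LWB mulmx0 add0r.
    by rewrite mul_row_block !mul_mx_row mul_row_block !(mulmx0, addr0, add0r, mulmx1) BK BH.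
apply: pequiv_trans step1 _.
have [c' [E [cE eE]]] := pext_lpencil ps.
have [c1 e1] := pext_square M.
have cS := is_complement_psum c1 cE.
have st2 := @pequiv_pext _ (Pencil Kb (L *m B *m Kb)) (psum (Pencil 1%:M M) (lpencil ps)) _ _ _ _ e compK cS.
have st3 := @pext_psum _ (Pencil 1%:M M) (lpencil ps) 0%N _ 0 E.
have st4 := pequiv_trans st2 (pequiv_trans st3 (pequiv_psum e1 eE)).
apply: pequiv_trans (pequiv_psum st4 (lpencil0 d)) _.
apply: pequiv_trans (pequiv_sym (psumA _ _ _)) _.
apply: pequiv_psum (pequiv_refl _) _.
exact: lpencil_cat.
Qed.

Lemma kFt_mul p q (M : 'M[K]_(p, q)) i j :
  ((kF K p)^T *m M) i j = if insub (val i) is Some i' then M i' j else 0.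
Proof.
rewrite mxE; case: insubP => [i' _ ei|ni].
  rewrite (bigD1 i') //= big1 => [|k nk]; rewrite !mxE -?ei ?eqxx ?mul1r ?addr0 //.
  by rewrite val_eqE (negPf nk) mul0r.
rewrite big1 // => k _; rewrite !mxE; case: eqP => [e|_]; rewrite ?mul0r//.
by move: ni; rewrite /= -e ltn_ord.
Qed.

Lemma kGt_mul p q (M : 'M[K]_(p, q)) i j :
  ((kG K p)^T *m M) i j = if unlift ord0 i is Some i' then M i' j else 0.
Proof.
rewrite mxE; case: unliftP => [i' ->|->].
  rewrite (bigD1 i') //= big1 => [|k nk]; rewrite !mxE /bump /= ?eqxx ?mul1r ?addr0 //.
  by rewrite eqSS val_eqE (negPf nk) mul0r.
by rewrite big1 // => k _; rewrite !mxE mul0r.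
Qed.

Lemma mul_kFt p q (M : 'M[K]_(q, p.+1)) i j :
  (M *m (kF K p)^T) i j = M i (widen_ord (leqnSn p) j).
Proof. by rewrite -[M]trmxK -trmx_mul mxE kFE mul_rowsub_mx mul1mx !mxE. Qed.

Lemma mul_kGt p q (M : 'M[K]_(q, p.+1)) i j :
  (M *m (kG K p)^T) i j = M i (lift ord0 j).
Proof. by rewrite -[M]trmxK -trmx_mul mxE kGE mul_rowsub_mx mul1mx !mxE. Qed.

(** The block of size [p] describes the multiplications by [y] and by [x] from binary
    forms of degree [p - 1] to binary forms of degree [p].  The substitution
    [y |-> y - a x] turns multiplication by [y + a x] into multiplication by [y];
    [T] is its matrix, with binomial coefficients as entries. *)
Lemma pshift_left_block a p :
  pequiv (pshift a (kblock_pencil (KLeft K p))) (kblock_pencil (KLeft K p)).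
Proof.
pose T k : 'M[K]_k :=
  \matrix_(i, j) (if (j <= i)%N then 'C(k.-1 - j, i - j)%:R * (- a) ^+ (i - j) else 0).
have Tu k : T k \in unitmx.
  rewrite unitmxE det_trig; last by apply/is_trig_mxP => i j ij; rewrite mxE leqNgt ij.
  by rewrite big1 ?unitr1// => i _; rewrite mxE leqnn subnn bin0 expr0 mulr1.
exists (T p.+1), (invmx (T p.+1)), (T p), (invmx (T p)); split.
- by rewrite mulmxV// mulVmx.
- by rewrite mulmxV// mulVmx.
- rewrite /=; apply/matrixP => i j.
  rewrite mulmxDr -scalemxAr mxE mul_kFt [X in _ + X]mxE mul_kGt kFt_mul !mxE /=.
  have -> : bump 0 j = j.+1 by [].
  have ji := ltn_ord j; have ii := ltn_ord i.
  have pj : (p - j = (p.-1 - j).+1)%N by lia.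
  case: insubP => [i' _ /= ei|]; rewrite ?mxE ?ei.
    case: (ltngtP j i) => [ij|ij|ij]; last first.
    - by rewrite ij subnn !bin0 mulr0 addr0.
    - by rewrite mulr0 addr0.
    have -> : (i - j = (i - j.+1).+1)%N by lia.
    have -> : (p - j.+1 = p.-1 - j)%N by lia.
    rewrite pj binS natrD exprS; ring.
  rewrite -leqNgt => pi; have -> : (i = p :> nat) by lia.
  rewrite ltnW // ji; have -> : (p - j.+1 = p.-1 - j)%N by lia.
  rewrite pj !binn exprS; ring.
- rewrite /=; apply/matrixP => i j.
  rewrite mul_kGt kGt_mul !mxE /=.
  case: unliftP => [i' ->|->]; rewrite ?mxE //= /bump /= !add1n ltnS.
  by rewrite subSS; have -> : (p - j.+1 = p.-1 - j)%N by lia.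
Qed.
End InjectivePencils.

(** * Existence of the Kronecker canonical form *)

Section KroneckerExistence.
Variable K : numClosedFieldType.

(** The pencil [(A - a B, B)] has an injective first matrix, so it is a sum of a square
    part [(1, M)] and left singular blocks; undoing the shift preserves the left blocks,
    and the square part is handled by the Jordan form. *)
Theorem kcf_exists n m (A B : 'M[K]_(n, m)) (a : K) (L : 'M_(m, n)) :
  L *m (A - a *: B) = 1%:M -> exists s, is_kcf A B s.
Proof.
move=> LA; have [q [M [ps e]]] := injective_pencil_form B LA; apply: has_kcf_is_kcf.
have -> : Pencil A B = pshift a (Pencil (A - a *: B) B) by rewrite /pshift /= subrK.
apply: (has_kcf_equiv (pequiv_pshift a e)); rewrite pshift_psum.
apply: has_kcf_psum; first exact: has_kcf_shift_id.
exists [seq KLeft K p | p <- ps]; elim: ps {e} => [|p ps IH] /=.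
  by rewrite /pshift /lpencil /kpencil /= scaler0 addr0; apply: pequiv_refl.
change (pequiv (pshift a (psum (kblock_pencil (KLeft K p)) (lpencil K ps)))
  (psum (kblock_pencil (KLeft K p)) (kpencil [seq KLeft K p | p <- ps]))).
rewrite pshift_psum; apply: pequiv_psum IH; exact: pshift_left_block.
Qed.
End KroneckerExistence.

(** * Finite eigenvalues read off from a canonical form *)

Section FiniteSpectrum.
Variable K : fieldType.
Implicit Types (S : pred K) (b : kblock K) (s : seq (kblock K)).

(** The contribution of a block to the algebraic multiplicities of the eigenvalues in [S]. *)
Definition finite_size S b : nat :=
  if b is KFinite p a then if S a then p.+1 else 0%N else 0%N.

Lemma sum_algmult n m (A B : 'M[K]_(n, m)) (S : {fset K}) :
  (\sum_(l <- S) algmult A B l = \sum_(b <- kcf A B) finite_size (mem S) b)%N.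
Proof.
rewrite exchange_big /=; apply: eq_bigr => -[p a|p|p|p] _ /=; try by rewrite big1.
case: ifP => aS; last first.
  by apply: big1_seq => l /= lS; case: eqP => // e; rewrite e lS in aS.
rewrite (bigD1_seq a) ?fset_uniq//= eqxx big1 ?addn0// => l la.
by rewrite eq_sym (negPf la).
Qed.

Lemma finite_block_invariant S b :
  exists (X : 'M[K]_(kb_cols b, finite_size S b)) (X' : 'M_(finite_size S b, kb_cols b))
         (T : 'M_(finite_size S b)),
  [/\ X' *m X = 1%:M, kb_A b *m X = kb_B b *m X *m T,
      forall i j : 'I__, (j < i)%N -> T i j = 0 & forall i, S (T i i)].
Proof.
case: b => [p a|p|p|p] /=; first (case: ifP => aS); last first.
- by exists 0, 0, 0; split; [apply/matrixP => -[]|rewrite !mulmx0|case|case].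
- by exists 0, 0, 0; split; [apply/matrixP => -[]|rewrite !mulmx0|case|case].
- by exists 0, 0, 0; split; [apply/matrixP => -[]|rewrite !mulmx0|case|case].
- by exists 0, 0, 0; split; [apply/matrixP => -[]|rewrite !mulmx0|case|case].
exists 1%:M, 1%:M, (jordan_block p.+1 a); split.
- by rewrite mul1mx.
- by rewrite mulmx1 !mul1mx.
- move=> i j ji; rewrite mxE; case: eqP => [e|_]; first by rewrite e ltnn in ji.
  by case: eqP => // e; move: ji; rewrite -e ltnNge leqnSn.
- by move=> i; rewrite mxE eqxx.
Qed.

Lemma kdiag_invariant S s : exists N, N = (\sum_(b <- s) finite_size S b)%N /\
  exists (X : 'M[K]_(kdiag_cols s, N)) (X' : 'M_(N, kdiag_cols s)) (T : 'M_N),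
  [/\ X' *m X = 1%:M, kdiag (@kb_A K) s *m X = kdiag (@kb_B K) s *m X *m T,
      forall i j : 'I__, (j < i)%N -> T i j = 0 & forall i, S (T i i)].
Proof.
elim: s => [|b s [N [eN [X [X' [T [XX e Tt TS]]]]]]].
  exists 0%N; split; first by rewrite big_nil.
  by exists 0, 0, 0; split; [apply/matrixP => -[]|rewrite !mulmx0|case|case].
have [Y [Y' [U [YY f Ut US]]]] := finite_block_invariant S b.
exists (finite_size S b + N)%N; split; first by rewrite big_cons eN.
exists (block_mx Y 0 0 X), (block_mx Y' 0 0 X'), (block_mx U 0 0 T); split.
- by rewrite mulmx_block !(mulmx0, mul0mx, addr0, add0r) YY XX -scalar_mx_block.
- by rewrite /= !mulmx_block !(mulmx0, mul0mx, addr0, add0r) f e.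
- move=> i j; case: (splitP i) => i' ei; case: (splitP j) => j' ej; rewrite ei ej => ji.
  + have -> : i = lshift _ i' by apply: val_inj.
    have -> : j = lshift _ j' by apply: val_inj.
    by rewrite block_mxEul Ut.
  + by have := ltn_ord i'; lia.
  + have -> : i = rshift _ i' by apply: val_inj.
    have -> : j = lshift _ j' by apply: val_inj.
    by rewrite block_mxEdl mxE.
  + have -> : i = rshift _ i' by apply: val_inj.
    have -> : j = rshift _ j' by apply: val_inj.
    by rewrite block_mxEdr Tt//; lia.
- move=> i; case: (splitP i) => i' ei.
    have -> : i = lshift _ i' by apply: val_inj.
    by rewrite block_mxEul.
  have -> : i = rshift _ i' by apply: val_inj.
  by rewrite block_mxEdr.
Qed.

(** The columns of [Q] belonging to the finite blocks with eigenvalue in [S] satisfy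
    [A X = B X T] with [T] a direct sum of Jordan blocks.  Since [T] is upper
    triangular, the first [r] of these columns still satisfy such an equation. *)
Lemma is_kcf_invariant n m (A B : 'M[K]_(n, m)) s S r : is_kcf A B s ->
  (r <= \sum_(b <- s) finite_size S b)%N ->
  exists (X : 'M[K]_(m, r)) (X' : 'M_(r, m)) (T : 'M_r),
  [/\ X' *m X = 1%:M, A *m X = B *m X *m T,
      forall i j : 'I__, (j < i)%N -> T i j = 0 & forall i, S (T i i)].
Proof.
move=> [P [Q [en [em [Pu Qu eA eB]]]]] rs.
have [N [eN [X [X' [T [XX e Tt TS]]]]]] := kdiag_invariant S s.
subst n m; rewrite !castmx_id in eA eB.
rewrite -eN in rs; pose w := widen_ord rs.
exists (colsub w (Q *m X)), (rowsub w (X' *m invmx Q)), (mxsub w w T); split.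
- rewrite -mul_rowsub_mx -mulmx_colsub -!mulmxA (mulmxA (invmx Q)) mulVmx// mul1mx.
  rewrite mulmx_colsub mul_rowsub_mx XX; apply/matrixP => i j; rewrite !mxE.
  by congr (_%:R); rewrite -!val_eqE.
- have AX : A *m (Q *m X) = B *m (Q *m X) *m T.
    apply: (mulmx_left_inj (mulVmx Pu)).
    by rewrite !mulmxA eA eB.
  rewrite -mulmxA; have -> : colsub w (Q *m X) *m mxsub w w T = colsub w (Q *m X *m T).
    apply/matrixP => i j; rewrite [LHS]mxE [RHS]mxE [RHS]mxE.
    rewrite [RHS](bigID (fun k : 'I_N => (k < r)%N)) /= big_ord_narrow.
    rewrite [X in _ = _ + X]big1 ?addr0 => [|k]; last first.
      by rewrite -leqNgt => rk; rewrite Tt ?mulr0//=; apply: leq_trans rk.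
    by apply: eq_bigr => k _; rewrite !mxE.
  by rewrite !mulmx_colsub AX -mulmxA.
- by move=> i j ji; rewrite mxE Tt.
- by move=> i; rewrite mxE.
Qed.

Lemma jordan_block0_fixed p r (Z : 'M[K]_(p, r)) (D : 'M_r) :
  Z = jordan_block p 0 *m Z *m D -> Z = 0.
Proof.
move=> e; suff H k (i : 'I_p) : (p <= i + k)%N -> row i Z = 0.
  by apply/row_matrixP => i; rewrite (H p) ?row0 ?leq_addl.
elim: k i => [|k IH] i ik; first by have := ltn_ord i; lia.
rewrite e row_mul (_ : row i _ = 0) ?mul0mx//.
apply/rowP => j; rewrite mxE jordan_block0_mul mxE; case: insubP => // i' _ ei.
have pk : (p <= i' + k)%N by move: ei => /= ->; rewrite addSn -addnS.
by have /rowP/(_ j) := IH i' pk; rewrite !mxE.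
Qed.

Lemma left_block_no_spectrum p r (Z : 'M[K]_(p, r)) (C : 'M_r) :
  (kF K p)^T *m Z = (kG K p)^T *m Z *m C -> Z = 0.
Proof.
move=> e; suff H k (i : 'I_p) : (i < k)%N -> row i Z = 0.
  by apply/row_matrixP => i; rewrite (H p) ?row0.
elim: k i => // k IH i ik; apply/rowP => j; rewrite !mxE.
have := congr1 (fun M : 'M_(p.+1, r) => M (widen_ord (leqnSn p) i) j) e.
rewrite /= -mulmxA kFt_mul kGt_mul insubT ?ltn_ord//= => lt.
rewrite (_ : Sub _ _ = i); last exact: val_inj.
case: unliftP => [i' ei|_] -> //.
have /(congr1 val) := ei; rewrite /= /bump leq0n add1n => ei'.
have -> : (Z *m C) i' j = row (i' : 'I_p) (Z *m C) 0 j by rewrite [RHS]mxE.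
by rewrite row_mul IH ?mul0mx ?mxE//; lia.
Qed.

(** On a block, [A Z = B Z C] is a recurrence on the rows of [Z].  It forces [Z = 0] on the
    blocks with infinite eigenvalue, on the left singular blocks and on the finite
    blocks whose eigenvalue is not an eigenvalue of [C]; right singular blocks are
    excluded because [A - a B] is injective. *)
Lemma finite_block_spectrum S b r (Z : 'M[K]_(kb_cols b, r)) (C : 'M_r) a L :
  (forall x, ~~ S x -> C - x%:M \in unitmx) ->
  L *m (kb_A b - a *: kb_B b) = 1%:M ->
  kb_A b *m Z = kb_B b *m Z *m C -> (\rank Z <= finite_size S b)%N.
Proof.
move=> CS; case: b L Z => [p x|p|p|p] /= L Z LA e.
- case: ifP => xS; first exact: rank_leq_row.
  have Cu : C - x%:M \in unitmx by apply: CS; rewrite xS.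
  rewrite (@jordan_block0_fixed _ _ Z (invmx (C - x%:M))) ?mxrank0//.
  have -> : jordan_block p.+1 0 = jordan_block p.+1 x - x%:M.
    by apply/matrixP => i j; rewrite !mxE; case: eqP => _; rewrite ?mulr1n ?mulr0n ?subrr ?subr0.
  by rewrite mulmxBl e mul1mx -scalar_mxC -mulmxBr mulmxK.
- by rewrite (@jordan_block0_fixed _ _ Z C) ?mxrank0// -e mul1mx.
- have := mulmx1_min LA; lia.
- by rewrite (left_block_no_spectrum e) mxrank0.
Qed.

Lemma kdiag_spectrum S s r (Z : 'M[K]_(kdiag_cols s, r)) (C : 'M_r) a L :
  (forall x, ~~ S x -> C - x%:M \in unitmx) ->
  L *m (kdiag (@kb_A K) s - a *: kdiag (@kb_B K) s) = 1%:M ->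
  kdiag (@kb_A K) s *m Z = kdiag (@kb_B K) s *m Z *m C ->
  (\rank Z <= \sum_(b <- s) finite_size S b)%N.
Proof.
move=> CS; elim: s Z L => [|b s IH] /= Z L LA e; first by rewrite flatmx0 mxrank0.
rewrite big_cons; move: LA e; rewrite -[Z]vsubmxK -[L]submxK.
rewrite scale_block_mx opp_block_mx add_block_mx !(scaler0, oppr0, addr0).
rewrite !mulmx_block scalar_mx_block => /eq_block_mx [LA _ _ LD].
rewrite !(mulmx0, mul0mx, addr0, add0r) in LA LD.
rewrite !mul_block_col !(mulmx0, mul0mx, addr0, add0r) mul_col_mx => /eq_col_mx [eu ed].
apply: leq_trans (leq_add (finite_block_spectrum CS LA eu) (IH _ _ LD ed)).
by rewrite -addsmxE; apply: mxrank_adds_leqif.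
Qed.

(** In the coordinates of the canonical form, [V] is supported on the finite blocks with
    eigenvalue in [S], which therefore have at least [rank V] columns. *)
Lemma is_kcf_spectrum n m (A B : 'M[K]_(n, m)) s S r (V : 'M_(m, r)) (C : 'M_r) a L :
  is_kcf A B s -> (forall x, ~~ S x -> C - x%:M \in unitmx) ->
  L *m (A - a *: B) = 1%:M -> \rank V = r -> A *m V = B *m V *m C ->
  (r <= \sum_(b <- s) finite_size S b)%N.
Proof.
move=> [P [Q [en [em [Pu Qu eA eB]]]]] CS LA rV e.
subst n m; rewrite !castmx_id in eA eB.
have -> : r = \rank (invmx Q *m V) by rewrite -{1}rV eqmxMfull // row_full_unit unitmx_inv.
apply: (@kdiag_spectrum _ _ _ _ C a (invmx Q *m L *m invmx P)) => //.
  rewrite -eA -eB scalemxAl scalemxAr -mulmxBl -mulmxBr.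
  by rewrite !mulmxA (mulmxKV Pu) -(mulmxA _ L) LA mulmx1 mulVmx.
by rewrite -eA -eB -!(mulmxA _ Q) !mulKVmx// -!mulmxA e !mulmxA.
Qed.

End FiniteSpectrum.

(** * The real inner product on complex vectors *)

Section RealInnerProduct.
Variable R : realType.
Local Notation C := R[i].

(** The real part of the Hermitian product: a real inner product with the same norm. *)
Definition rdot k (a b : 'cV[C]_k) : R :=
  \sum_i (complex.Re (a i 0) * complex.Re (b i 0) + complex.Im (a i 0) * complex.Im (b i 0)).

Definition sqn k (a : 'cV[C]_k) : R := rdot a a.

Definition nsq (z : C) : R := complex.Re z ^+ 2 + complex.Im z ^+ 2.

Lemma ReD (x y : C) : complex.Re (x + y) = complex.Re x + complex.Re y.
Proof. by case: x; case: y. Qed.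

Lemma Re_sum (I : finType) (F : I -> C) :
  complex.Re (\sum_i F i) = \sum_i complex.Re (F i).
Proof. exact: (big_morph _ ReD (erefl : complex.Re (0 : C) = 0)). Qed.

Lemma Re_dot k (a b : 'cV[C]_k) : complex.Re ((a ^t* *m b) 0 0) = rdot a b.
Proof.
rewrite mxE Re_sum; apply: eq_bigr => i _; rewrite !mxE.
by case: (a i 0) (b i 0) => [x y] [u v] /=; ring.
Qed.

Lemma rdotC k (a b : 'cV[C]_k) : rdot a b = rdot b a.
Proof. by apply: eq_bigr => i _; ring. Qed.

Lemma rdotDl k (a b c : 'cV[C]_k) : rdot (a + b) c = rdot a c + rdot b c.
Proof.
rewrite -big_split; apply: eq_bigr => i _ /=; rewrite !mxE.
by case: (a i 0) (b i 0) (c i 0) => [x y] [u v] [w z] /=; ring.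
Qed.

Lemma rdotDr k (a b c : 'cV[C]_k) : rdot c (a + b) = rdot c a + rdot c b.
Proof. by rewrite rdotC rdotDl !(rdotC c). Qed.

Lemma rdot0r k (a : 'cV[C]_k) : rdot a 0 = 0.
Proof. by apply: big1 => i _; rewrite mxE /= !mulr0 addr0. Qed.

Lemma rdotZl k (s : R) (a b : 'cV[C]_k) : rdot ((s%:C)%C *: a) b = s * rdot a b.
Proof.
rewrite mulr_sumr; apply: eq_bigr => i _; rewrite !mxE.
by case: (a i 0) (b i 0) => [x y] [u v] /=; ring.
Qed.

Lemma rdotZr k (s : R) (a b : 'cV[C]_k) : rdot a ((s%:C)%C *: b) = s * rdot a b.
Proof. by rewrite rdotC rdotZl rdotC. Qed.

Lemma rdotZZ k (z : C) (a b : 'cV[C]_k) : rdot (z *: a) (z *: b) = nsq z * rdot a b.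
Proof.
rewrite mulr_sumr; apply: eq_bigr => i _; rewrite !mxE /nsq.
by case: (a i 0) (b i 0) z => [x y] [u v] [w z] /=; ring.
Qed.

Lemma sqnE k (a : 'cV[C]_k) : sqn a = \sum_i nsq (a i 0).
Proof. by apply: eq_bigr => i _; rewrite /nsq !expr2. Qed.

Lemma nsq_ge0 z : 0 <= nsq z.
Proof. by rewrite addr_ge0 ?sqr_ge0. Qed.

Lemma nsq_eq0 z : (nsq z == 0) = (z == 0).
Proof.
case: z => x y; rewrite /nsq /= paddr_eq0 ?sqr_ge0// !sqrf_eq0.
by rewrite eq_complex.
Qed.

Lemma conj_mul_self (z : C) : z^* * z = ((nsq z)%:C)%C.
Proof.
by case: z => [a b]; rewrite /nsq; apply/eqP; rewrite eq_complex /=; apply/andP; split; apply/eqP; ring.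
Qed.

Lemma sqn_ge0 k (a : 'cV[C]_k) : 0 <= sqn a.
Proof. by rewrite sqnE sumr_ge0// => i _; apply: nsq_ge0. Qed.

Lemma sqn_eq0 k (a : 'cV[C]_k) : (sqn a == 0) = (a == 0).
Proof.
rewrite sqnE psumr_eq0 => [|i _]; last exact: nsq_ge0.
apply/allP/eqP => [h|-> i _]; last by rewrite /= mxE nsq_eq0 eqxx.
apply/colP => i; have := h i; rewrite mem_index_enum => /(_ isT).
by rewrite /= nsq_eq0 => /eqP ->; rewrite mxE.
Qed.

Lemma sqn0 k : sqn (0 : 'cV[C]_k) = 0.
Proof. by apply/eqP; rewrite sqn_eq0. Qed.

Lemma sqn_gt0 k (a : 'cV[C]_k) : (0 < sqn a) = (a != 0).
Proof. by rewrite lt0r sqn_ge0 andbT sqn_eq0. Qed.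

Lemma sqnZ k z (a : 'cV[C]_k) : sqn (z *: a) = nsq z * sqn a.
Proof. exact: rdotZZ. Qed.

Lemma sqnD k (a b : 'cV[C]_k) : sqn (a + b) = sqn a + 2 * rdot a b + sqn b.
Proof. by rewrite /sqn !rdotDl !rdotDr (rdotC b a); ring. Qed.

Lemma nsqR (s : R) : nsq (s%:C)%C = s ^+ 2.
Proof. by rewrite /nsq /= expr0n addr0. Qed.

(** Expand the squared length of [e a + b] and divide by [e]. *)
Lemma rdot_amgm k (e : R) (a b : 'cV[C]_k) : 0 < e ->
  - (e * sqn a + e^-1 * sqn b) <= 2 * rdot a b.
Proof.
move=> e0; have := sqn_ge0 ((e%:C)%C *: a + b).
rewrite sqnD sqnZ nsqR rdotZl => h.
have -> : 2 * rdot a b = e^-1 * (2 * (e * rdot a b)) by field; rewrite gt_eqF.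
rewrite -(ler_pM2l e0) mulVKf ?gt_eqF// mulrN mulrDr mulVKf ?gt_eqF//.
lra.
Qed.

Lemma trmxCM m n p (A : 'M[C]_(m, n)) (B : 'M_(n, p)) : (A *m B) ^t* = B ^t* *m A ^t*.
Proof. by rewrite trmx_mul map_mxM. Qed.

Lemma sqn_isometry m n (W : 'M[C]_(m, n)) x : W ^t* *m W = 1%:M -> sqn (W *m x) = sqn x.
Proof.
move=> WW; rewrite /sqn -!Re_dot trmxCM -mulmxA (mulmxA (W ^t*)) WW mul1mx //.
Qed.

End RealInnerProduct.

(** * Counting in a nonincreasing sequence *)

Section Sorted.
Variable R : realDomainType.

Lemma ge_transitive : transitive (fun x y : R => y <= x).
Proof. by move=> a b d h1 h2; apply: le_trans h2 h1. Qed.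

Lemma lt_nth_sorted (t : seq R) (c : R) i : 0 <= c ->
  sorted (fun x y => y <= x) t -> (c < nth 0 t i) = (i < count (fun x => (c < x)%R) t)%N.
Proof.
move=> c0; elim: t i => [|x t IH] i st /=; first by rewrite nth_nil ltNge c0.
have tr := ge_transitive.
have at' : all (fun y => y <= x) t by move: st => /=; rewrite path_sortedE// => /andP[].
have st' : sorted (fun x y => y <= x) t by apply: path_sorted st.
have [cx|xc] := ltP c x.
  by case: i => [|i] /=; rewrite ?cx// IH.
have -> : count (fun y => c < y) t = 0%N.
  apply/eqP; rewrite -leqn0 leqNgt -has_count; apply/hasPn => y yt /=.
  by rewrite -leNgt (le_trans _ xc)//; apply: (allP at').
rewrite addn0 ltn0 ltNge; apply/negbF.
case: i => //= i; have [it|it] := ltnP i (size t); last by rewrite nth_default.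
by rewrite (le_trans _ xc)//; apply: (allP at'); apply: mem_nth.
Qed.

Lemma count_ge_nth_sorted (t : seq R) i :
  sorted (fun x y => y <= x) t -> (i < size t)%N ->
  (i < count (fun x => (nth 0%R t i <= x)%R) t)%N.
Proof.
have tr := ge_transitive.
elim: t i => // x t IH [|i] /= st it; first by rewrite lexx.
have at' : all (fun y => y <= x) t by move: st => /=; rewrite path_sortedE// => /andP[].
rewrite (allP at') ?mem_nth// add1n ltnS; apply: IH => //.
exact: path_sorted st.
Qed.

Lemma count_gt_simple (t : seq R) i :
  sorted (fun x y => y <= x) t -> (i < size t)%N ->
  count_mem (nth 0 t i) t = 1%N ->
  (i <= count (fun x => (nth 0%R t i < x)%R) t)%N.
Proof.
move=> st it c1; have := count_ge_nth_sorted st it.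
set c := nth 0 t i in c1 *.
rewrite (eq_count (a2 := predU (fun x => c < x) (pred1 c))); last first.
  by move=> x /=; rewrite le_eqVlt orbC eq_sym.
by have := count_predUI (fun x => c < x) (pred1 c) t; rewrite c1; lia.
Qed.

End Sorted.

(** * Singular values as eigenvalues of the Gram matrix *)

Section Sigma.
Variable R : realType.
Local Notation C := R[i].
Variables (l k : nat) (M : 'M[C]_(l, k)).
Hypothesis kl : (k <= l)%N.

Let N := M ^t* *m M.
Let P := spectralmx N.
Definition gram_eig (j : 'I_k) : R := complex.Re (spectral_diag (M ^t* *m M) 0 j).

Lemma gram_herm : N \is hermsymmx.
Proof. by apply/is_hermitianmxP; rewrite expr0 scale1r /N trmxCM trmxCK. Qed.

Lemma gram_spectral : N *m P ^t* = P ^t* *m diag_mx (\row_j ((gram_eig j)%:C)%C).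
Proof.
have := hermitian_normalmx gram_herm => /orthomx_spectralP e.
rewrite {1}e -/P invmx_unitary ?spectral_unitarymx//.
rewrite -!mulmxA (unitarymxP (spectral_unitarymx _)) mulmx1; congr (_ *m diag_mx _).
apply/rowP => j; rewrite !mxE /gram_eig RRe_real//.
exact: (mxOverP (hermitian_spectral_diag_real gram_herm)).
Qed.

Lemma PPt : P *m P ^t* = 1%:M. Proof. exact/unitarymxP/spectral_unitarymx. Qed.
Lemma PtP : P ^t* *m P = 1%:M. Proof. by apply: mulmx1C; apply: PPt. Qed.

Lemma sqn_mul x : sqn (M *m x) = \sum_j gram_eig j * nsq ((P *m x) j 0).
Proof.
have eN : N = P ^t* *m (diag_mx (\row_j ((gram_eig j)%:C)%C) *m P).
  by rewrite mulmxA -gram_spectral -mulmxA PtP mulmx1.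
rewrite /sqn -Re_dot trmxCM -mulmxA (mulmxA (M ^t*)) -/N eN.
rewrite -!mulmxA mulmxA -trmxCM Re_dot; move: (P *m x) => y.
apply: eq_bigr => j _; rewrite mul_diag_mx !mxE /nsq.
by case: (y j 0) => u v /=; ring.
Qed.

Lemma gram_eig_ge0 j : 0 <= gram_eig j.
Proof.
have := sqn_ge0 (M *m (P ^t* *m delta_mx j 0)).
rewrite sqn_mul mulmxA PPt mul1mx (bigD1 j) //= big1 => [|i ij].
  by rewrite mxE !eqxx /nsq /= expr1n expr0n !addr0 mulr1.
by rewrite mxE (negPf ij) /nsq /= expr0n !addr0 mulr0.
Qed.

Lemma singvals_sorted : sorted (fun x y => y <= x) (singvals M).
Proof.
have tr := @ge_transitive (R : realDomainType).
by apply/take_sorted/sort_sorted => a b; apply: le_total.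
Qed.

Lemma count_singvals (p : pred R) :
  count p (singvals M) = #|[pred j | p (Num.sqrt (gram_eig j))]|.
Proof.
rewrite /singvals take_oversize; last by rewrite size_sort size_map size_enum_ord (minn_idPr kl).
rewrite (permP (permEl (perm_sort _ _))) count_map -sum1_count -sum1_card.
by rewrite big_enum_cond; apply: eq_bigl => j.
Qed.

Lemma sigma_gt_card c p : 0 <= c -> (0 < p)%N ->
  (c < sigma p M) = (p <= #|[pred j | (c ^+ 2 < gram_eig j)%R]|)%N.
Proof.
move=> c0 p0; rewrite /sigma lt_nth_sorted ?singvals_sorted// prednK// count_singvals.
congr (_ <= _)%N; apply: eq_card => j; rewrite !inE.
have [g0|] := ltP 0 (gram_eig j).
  by rewrite -{1}(ger0_norm c0) -sqrtr_sqr ltr_sqrt.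
rewrite le_eqVlt ltNge gram_eig_ge0 orbF => /eqP ->.
by rewrite sqrtr0 !ltNge c0 sqr_ge0.
Qed.

Lemma gram_eigenvectors q c : (q <= #|[pred j | (c ^+ 2 < gram_eig j)%R]|)%N ->
  exists (W : 'M[C]_(k, q)) (d : 'I_q -> R),
    [/\ W ^t* *m W = 1%:M,
        M ^t* *m M *m W = W *m diag_mx (\row_j ((d j)%:C)%C)
      & forall j, c ^+ 2 < d j].
Proof.
move=> qJ; pose f (i : 'I_q) : 'I_k := enum_val (widen_ord qJ i).
have f_inj : injective f by move=> i j /enum_val_inj /(congr1 val) /= /val_inj.
exists (colsub f (P ^t*)), (fun i => gram_eig (f i)); split.
- have -> : (colsub f (P ^t*)) ^t* = rowsub f P.
    by rewrite -[in RHS](trmxCK P); apply/matrixP => i j; rewrite !mxE.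
  rewrite mulmx_colsub mul_rowsub_mx PPt; apply/matrixP => i j; rewrite !mxE.
  by rewrite (inj_eq f_inj).
- rewrite mulmx_colsub gram_spectral; apply/matrixP => i j.
  by rewrite !mul_mx_diag !mxE.
- by move=> j; have := enum_valP (widen_ord qJ j); rewrite inE.
Qed.

End Sigma.

(** * Variational characterization of singular values *)

Section SigmaBounds.
Variable R : realType.
Local Notation C := R[i].

(** Courant-Fischer.  One direction takes eigenvectors of the Gram matrix; for the other,
    if fewer than [p] Gram eigenvalues exceed [c ^ 2], some nonzero vector of a
    [p]-dimensional space is orthogonal to all their eigenvectors. *)
Lemma sigma_gtP l k (M : 'M[C]_(l, k)) c p : (k <= l)%N -> 0 <= c -> (0 < p)%N ->
  c < sigma p M <->
  exists W : 'M[C]_(k, p), forall x, x != 0 -> c ^+ 2 * sqn (W *m x) < sqn (M *m (W *m x)).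
Proof.
move=> kl c0 p0; rewrite sigma_gt_card//; split.
  move=> /gram_eigenvectors [W [d [WW NW dc]]]; exists W => x x0.
  rewrite sqn_isometry//.
  have -> : sqn (M *m (W *m x)) = rdot x (diag_mx (\row_j ((d j)%:C)%C) *m x).
    rewrite /sqn -Re_dot trmxCM -mulmxA (mulmxA (M ^t*)) (mulmxA _ W) NW.
    by rewrite trmxCM -!mulmxA (mulmxA (W ^t*)) WW mul1mx Re_dot.
  rewrite /sqn /rdot mulr_sumr -subr_gt0 -sumrB.
  have [i xi] := cV0Pn _ x0.
  have E (j : 'I_p) : complex.Re (x j 0) * complex.Re ((diag_mx (\row_j ((d j)%:C)%C) *m x) j 0) +
     complex.Im (x j 0) * complex.Im ((diag_mx (\row_j ((d j)%:C)%C) *m x) j 0)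
     - c ^+ 2 * (complex.Re (x j 0) * complex.Re (x j 0) + complex.Im (x j 0) * complex.Im (x j 0)) =
     (d j - c ^+ 2) * nsq (x j 0).
    rewrite mul_diag_mx !mxE /nsq.
    by case: (x j 0) => u v /=; ring.
  under eq_bigr do rewrite E.
  rewrite (bigD1 i)//= ltr_wpDr ?sumr_ge0// => [j _|].
    by rewrite mulr_ge0 ?nsq_ge0// subr_ge0 ltW.
  by rewrite mulr_gt0 ?subr_gt0// lt0r nsq_ge0 nsq_eq0 xi.
move=> [W hW]; rewrite leqNgt; apply/negP => Jp.
pose Q := spectralmx (M ^t* *m M).
pose J : pred 'I_k := [pred j | c ^+ 2 < gram_eig M j].
have [x x0 Ax] := nonzero_kernel (rowsub (enum_val (A := J)) (Q *m W)) Jp.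
have := hW x x0; rewrite [sqn (M *m _)]sqn_mul -/Q -[sqn (W *m x)](sqn_isometry (W := Q)); last exact: PtP.
apply/negP; rewrite -leNgt sqnE mulr_sumr; apply: ler_sum => j _.
have [cj|jc] := ltP (c ^+ 2) (gram_eig M j); last by rewrite ler_wpM2r ?nsq_ge0.
suff -> : (Q *m (W *m x)) j 0 = 0 by rewrite /nsq /= expr0n !addr0 !mulr0.
have jJ : j \in J by rewrite inE.
have /colP/(_ (enum_rank_in jJ j)) := Ax.
by rewrite mul_rowsub_mx [LHS]mxE enum_rankK_in// mulmxA => ->; rewrite mxE.
Qed.

Lemma sigma_ge0 l k (M : 'M[C]_(l, k)) p : 0 <= sigma p M.
Proof.
rewrite /sigma; have [lt|ge] := ltnP p.-1 (size (singvals M)); last by rewrite nth_default.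
have /mem_take := mem_nth 0 lt; rewrite mem_sort => /mapP [j _ ->].
exact: sqrtr_ge0.
Qed.

Lemma specnorm_bound l k (M : 'M[C]_(l, k)) x : (k <= l)%N ->
  sqn (M *m x) <= specnorm M ^+ 2 * sqn x.
Proof.
move=> kl; rewrite leNgt; apply/negP => h.
have : specnorm M < sigma 1 M.
  apply/sigma_gtP => //; first exact: sigma_ge0.
  exists (x : 'M_(k, 1)) => y y0.
  have ey : y = (y 0 0)%:M by apply: mx11_scalar.
  have y00 : 0 < nsq (y 0 0).
    by rewrite lt0r nsq_ge0 andbT nsq_eq0; apply: contraNneq y0 => e; rewrite ey e raddf0.
  rewrite ey mul_mx_scalar -scalemxAr !sqnZ.
  by rewrite mulrCA ltr_pM2l.
by rewrite ltxx.
Qed.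

Lemma specnorm_le l k (M : 'M[C]_(l, k)) c : (k <= l)%N -> 0 <= c ->
  (forall x, sqn (M *m x) <= c ^+ 2 * sqn x) -> specnorm M <= c.
Proof.
move=> kl c0 h; rewrite leNgt; apply/negP => /sigma_gtP [] // W hW.
have := hW 1%:M; rewrite -mxrank_eq0 mxrank1 => /(_ isT).
by apply/negP; rewrite -leNgt.
Qed.

(** Dually, a subspace of codimension less than [p] on which [M] is bounded by [c] meets
    every [p]-dimensional subspace. *)
Lemma sigma_le l k q (M : 'M[C]_(l, k)) (V : 'M[C]_(q, k)) c p :
  (k <= l)%N -> 0 <= c -> (0 < p)%N -> (k < p + \rank V)%N ->
  (forall v : 'rV_k, (v <= V)%MS -> sqn (M *m v^T) <= c ^+ 2 * sqn v^T) ->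
  sigma p M <= c.
Proof.
move=> kl c0 p0 kpV hV; rewrite leNgt; apply/negP => /sigma_gtP [] // W hW.
have rW : \rank W^T = p.
  apply/eqP; rewrite -[_ == p]/(row_free W^T).
  apply: row_free_trmx_of_injective => x Wx; apply/eqP; apply: contraT => /hW.
  by rewrite Wx mulmx0 !sqn0 mulr0 ltxx.
have : (W^T :&: V)%MS != 0.
  rewrite -mxrank_eq0; have := mxrank_sum_cap W^T V; rewrite rW.
  by have := rank_leq_col (W^T + V)%MS; lia.
case/rowV0Pn => v; rewrite sub_capmx => /andP [/submxP [u eu] vV] v0.
have u0 : u^T != 0 by rewrite trmx_eq0; apply: contraNneq v0 => e; rewrite eu e mul0mx.
have := hW _ u0; rewrite -[W]trmxK -trmx_mul -eu.
by apply/negP; rewrite -leNgt; apply: hV.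
Qed.

End SigmaBounds.

(** * First-order increase of a simple singular value *)

Section Increase.
Variable R : realType.
Local Notation C := R[i].

Lemma trmxCZ m n (z : C) (A : 'M[C]_(m, n)) : (z *: A) ^t* = z^* *: A ^t*.
Proof. by apply/matrixP => i j; rewrite !mxE rmorphM. Qed.

Lemma conj_real_complex (s : R) : ((s%:C)%C : C)^* = (s%:C)%C.
Proof. exact: conjc_real. Qed.

Lemma rdot_adj l k (M : 'M[C]_(l, k)) a b : rdot (M *m a) b = rdot a (M ^t* *m b).
Proof. by rewrite -!Re_dot trmxCM mulmxA. Qed.

Lemma sqn_eigenvectors l k q (M : 'M[C]_(l, k)) (W : 'M[C]_(k, q)) (d : 'I_q -> R) z :
  W ^t* *m W = 1%:M ->
  M ^t* *m M *m W = W *m diag_mx (\row_j ((d j)%:C)%C) ->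
  sqn (M *m (W *m z)) = \sum_j d j * nsq (z j 0).
Proof.
move=> WW NW; rewrite /sqn rdot_adj (mulmxA (M ^t*)) (mulmxA _ W) NW rdot_adj.
rewrite -!mulmxA (mulmxA (W ^t*)) WW mul1mx; apply: eq_bigr => j _.
rewrite mul_diag_mx !mxE /nsq; case: (z j 0) => u v /=; ring.
Qed.

Lemma positive_gap q (d : 'I_q -> R) c : (forall j, c < d j) ->
  exists2 e, 0 < e & forall j, c + e <= d j.
Proof.
move=> dc; exists (\big[Num.min/1]_j (d j - c)).
  by apply: lt_bigmin => // j _; rewrite subr_gt0.
move=> j; rewrite -lerBrDl; exact: bigmin_le_cond.
Qed.

(** The numerical core of the perturbation argument: along a direction of positive
    derivative [c], the gap [d] to the larger singular values absorbs the cross terms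
    once the step [s] is small. *)
Lemma quadratic_positive (s e c sg A Y d kE kM r1 r2 r3 r4 : R) :
  0 < d -> 0 < c -> 0 < sg -> 0 <= kE -> 0 <= kM -> 0 <= A -> 0 <= Y -> 0 < A + Y ->
  e = sg * c / (sg ^+ 2 + kE) ->
  s = d / (2 * (e^-1 * (kE + kM) + kM + kE) + 1) ->
  r1 = sg * A * c ->
  - (e * (sg ^+ 2 * A) + e^-1 * (kE * Y)) <= 2 * r2 ->
  - (e * (kE * A) + e^-1 * (kM * Y)) <= 2 * r3 ->
  - (kM * Y + kE * Y) <= 2 * r4 ->
  0 < d * Y + s * (2 * (r1 + r2 + r3 + r4)).
Proof.
move=> d0 c0 sg0 kE0 kM0 A0 Y0 AY ee es er1 h2 h3 h4.
have e0 : 0 < e by rewrite ee divr_gt0 ?mulr_gt0// ltr_pwDl// exprn_gt0.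
have ee' : e * (sg ^+ 2 + kE) = sg * c.
  by rewrite ee mulfVK// gt_eqF// ltr_pwDl// exprn_gt0.
set K0 := e^-1 * (kE + kM) + kM + kE in es *.
have K00 : 0 <= K0 by rewrite !addr_ge0// mulr_ge0 ?invr_ge0 ?addr_ge0// ltW.
have s0 : 0 < s by rewrite es divr_gt0//; lra.
have sK : s * (2 * K0 + 1) = d by rewrite es mulfVK// gt_eqF//; lra.
have h : sg * c * A - K0 * Y <= 2 * (r1 + r2 + r3 + r4).
  have -> : sg * c * A - K0 * Y = 2 * (sg * A * c) - (e * (sg ^+ 2 + kE)) * A - K0 * Y.
    by rewrite ee'; ring.
  rewrite er1 /K0; lra.
have := ler_pM2l s0 (sg * c * A - K0 * Y) (2 * (r1 + r2 + r3 + r4)); rewrite h => h'.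
apply: lt_le_trans (_ : d * Y + s * (sg * c * A - K0 * Y) <= _); last by lra.
rewrite -sK (_ : _ + _ = s * ((K0 + 1) * Y + sg * c * A)); last by ring.
rewrite mulr_gt0//.
have [A0'|] := ltP 0 A.
  by rewrite ltr_wpDl ?mulr_gt0// mulr_ge0//; lra.
move=> Ale; have -> : A = 0 by lra.
by rewrite mulr0 addr0 mulr_gt0//; lra.
Qed.

(** First-order perturbation theory without differentiation.  On the span of [V] and of
    the right singular vectors for the larger singular values, [M] stretches by at
    least [sigma p M].  Moving along [E], rotated so that [U^* E V] becomes positive,
    gains on [V] at first order and loses on the other vectors less than the gap
    provided by simplicity. *)
Lemma sigma_increase l k (M E : 'M[C]_(l, k)) p (U : 'cV[C]_l) (V : 'cV[C]_k) : (k <= l)%N -> (0 < p)%N ->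
  0 < sigma p M -> count_mem (sigma p M) (singvals M) = 1%N ->
  U ^t* *m U = 1%:M -> V ^t* *m V = 1%:M ->
  M *m V = ((sigma p M)%:C)%C *: U -> M ^t* *m U = ((sigma p M)%:C)%C *: V ->
  (U ^t* *m E *m V) 0 0 != 0 ->
  exists t : C, sigma p M < sigma p (M + t *: E).
Proof.
move=> kl; case: p => // q _; set sg := sigma _ M => sg0 simple UU VV MV MU w0.
have [W' [d [WW NW dsg]]] : exists (W : 'M[C]_(k, q)) (d : 'I_q -> R),
    [/\ W ^t* *m W = 1%:M,
        M ^t* *m M *m W = W *m diag_mx (\row_j ((d j)%:C)%C)
      & forall j, sg ^+ 2 < d j].
  apply: gram_eigenvectors.
  have [->//|q0] := posnP q.
  rewrite -sigma_gt_card ?(ltW sg0)//.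
  rewrite /sigma lt_nth_sorted ?(ltW sg0) ?singvals_sorted// prednK//.
  apply: count_gt_simple; rewrite ?singvals_sorted//.
  by rewrite ltnNge; apply/negP => qs; move: sg0; rewrite /sg /sigma nth_default// ltxx.
set w := (U ^t* *m E *m V) 0 0 in w0.
(* Rotating E by the conjugate of w = U^* E V makes the first variation positive. *)
pose E' := w^* *: E.
have [dl dl0 hd] := positive_gap dsg.
have c0 : 0 < nsq w by rewrite lt0r nsq_ge0 nsq_eq0 w0.
pose kE := specnorm E' ^+ 2; pose kM := specnorm M ^+ 2.
have hE x : sqn (E' *m x) <= kE * sqn x := specnorm_bound E' x kl.
have hM x : sqn (M *m x) <= kM * sqn x := specnorm_bound M x kl.
have kE0 : 0 <= kE by apply: sqr_ge0.
have kM0 : 0 <= kM by apply: sqr_ge0.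
(* With this weight e the cross terms take away half of the gain on V. *)
pose e := sg * nsq w / (sg ^+ 2 + kE).
pose s := dl / (2 * (e^-1 * (kE + kM) + kM + kE) + 1).
exists ((s%:C)%C * w^*); rewrite -scalerA -/E'.
apply/sigma_gtP => //; first exact: ltW.
exists (row_mx V W' : 'M_(k, 1 + q)) => x; rewrite -[x](@vsubmxK _ 1 q).
move: (@usubmx _ 1 q 1 x) (@dsubmx _ 1 q 1 x) => a z {x} az0.
have rc : (row_mx V W' : 'M_(k, q.+1)) *m (col_mx a z : 'cV_q.+1) = V *m a + W' *m z.
  by rewrite -(mul_row_col V W' a z).
rewrite rc.
have ea : a = (a 0 0)%:M by apply: mx11_scalar.
set al := a 0 0 in ea; rewrite ea mul_mx_scalar.
have sqnV : sqn V = 1.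
  by rewrite /sqn -Re_dot VV mxE eqxx.
have sqnU : sqn U = 1.
  by rewrite /sqn -Re_dot UU mxE eqxx.
have NV : M ^t* *m M *m V = ((sg ^+ 2)%:C)%C *: V.
  by rewrite -mulmxA MV -scalemxAr MU scalerA expr2 rmorphM.
(* Eigenvectors of the Gram matrix for different eigenvalues are orthogonal. *)
have VW : V ^t* *m W' = 0.
  have h : (M ^t* *m M *m V) ^t* *m W' = V ^t* *m W' *m diag_mx (\row_j ((d j)%:C)%C).
    by rewrite trmxCM -mulmxA trmxCM trmxCK -!mulmxA -NW !mulmxA.
  apply/matrixP => i j; have := congr1 (fun X : 'M_(1, q) => X i j) h.
  rewrite NV trmxCZ conj_real_complex -scalemxAl mul_mx_diag !mxE.
  set v := \sum_ _ _ => /eqP; rewrite mulrC -subr_eq0 -mulrBr mulf_eq0 => /orP [/eqP -> //|].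
  by rewrite -rmorphB fmorph_eq0 subr_eq0 lt_eqF.
set y := W' *m z.
have Vy : V ^t* *m y = 0 by rewrite /y mulmxA VW mul0mx.
have rVy : rdot (al *: V) y = 0.
  by rewrite -Re_dot trmxCZ -scalemxAl Vy scaler0 mxE.
have sx : sqn (al *: V + y) = nsq al + sqn y.
  by rewrite sqnD rVy sqnZ sqnV; ring.
have sMy : (sg ^+ 2 + dl) * sqn y <= sqn (M *m y).
  rewrite (sqn_eigenvectors _ WW NW) /y sqn_isometry// sqnE mulr_sumr.
  by apply: ler_sum => j _; rewrite ler_wpM2r ?nsq_ge0.
have MV' : M *m (al *: V) = al *: ((sg%:C)%C *: U) by rewrite -scalemxAr MV.
have sMx : sqn (M *m (al *: V + y)) = sg ^+ 2 * nsq al + sqn (M *m y).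
  rewrite mulmxDr sqnD rdotC rdot_adj rdotC.
  have -> : M ^t* *m (M *m (al *: V)) = ((sg ^+ 2)%:C)%C *: (al *: V).
    by rewrite mulmxA -scalemxAr NV scalerA mulrC -scalerA.
  rewrite rdotZl rVy MV' !sqnZ sqnU nsqR; ring.
rewrite sx mulmxDl sqnD sMx -scalemxAl.
rewrite rdotZr.
have AY : 0 < nsq al + sqn y.
  rewrite /y sqn_isometry//.
  have := nsq_ge0 al; have := sqn_ge0 z.
  have [al0|] := eqVneq al 0.
    have z0 : z != 0.
      by apply: contraNneq az0 => ->; rewrite ea al0 raddf0 col_mx0.
    by move: z0; rewrite -sqn_gt0; lra.
  by rewrite -nsq_eq0 => h h1 h2; rewrite ltr_pwDl// lt0r h.
have := sqn_ge0 ((s%:C)%C *: (E' *m (al *: V + y))).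
have := @quadratic_positive s e (nsq w) sg (nsq al) (sqn y) dl kE kM
  (rdot (M *m (al *: V)) (E' *m (al *: V))) (rdot (M *m (al *: V)) (E' *m y))
  (rdot (M *m y) (E' *m (al *: V))) (rdot (M *m y) (E' *m y))
  dl0 c0 sg0 kE0 kM0 (nsq_ge0 _) (sqn_ge0 _) AY erefl erefl.
set q1 := rdot (M *m (al *: V)) (E' *m (al *: V)).
set q2 := rdot (M *m (al *: V)) (E' *m y).
set q3 := rdot (M *m y) (E' *m (al *: V)).
set q4 := rdot (M *m y) (E' *m y).
have -> : rdot (M *m (al *: V + y)) (E' *m (al *: V + y)) = q1 + q2 + q3 + q4.
  by rewrite !mulmxDr rdotDl !rdotDr addrA.
move=> H hs.
suff : 0 < dl * sqn y + s * (2 * (q1 + q2 + q3 + q4)) by lra.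
have e0 : 0 < e by rewrite divr_gt0 ?mulr_gt0// ltr_pwDl// exprn_gt0.
have ie0 : 0 <= e^-1 by rewrite invr_ge0 ltW.
apply: H.
- rewrite /q1 MV' -scalemxAr rdotZZ rdotZl -Re_dot /E'.
  have -> : complex.Re ((U ^t* *m (w^* *: E *m V)) 0 0) = nsq w.
    by rewrite -scalemxAl -scalemxAr mxE mulmxA -/w conj_mul_self.
  ring.
- apply: le_trans (rdot_amgm _ _ e0); rewrite lerN2 lerD//.
    by rewrite MV' !sqnZ sqnU nsqR mulr1 (mulrC (nsq al)).
  by rewrite ler_wpM2l.
- rewrite /q3 rdotC; apply: le_trans (rdot_amgm _ _ e0); rewrite lerN2 lerD//.
    rewrite ler_pM2l//; apply: le_trans (hE _) _.
    by rewrite sqnZ sqnV mulr1.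
  by rewrite ler_wpM2l.
- apply: le_trans (rdot_amgm _ _ (ltr01 : 0 < 1)); rewrite lerN2 invr1 !mul1r.
  by rewrite lerD.
Qed.

End Increase.

(** * Perturbation to a pencil of full column rank *)

Section Perturb.
Variable R : realType.
Local Notation C := R[i].

Lemma small_nonroot (p : {poly C}) (e : R) : p != 0 -> 0 < e ->
  exists s : R, [/\ 0 < s, s < e & ~~ root p (s%:C)%C].
Proof.
move=> p0 e0.
pose f (i : nat) : C := ((e / i.+2%:R)%:C)%C.
have f_inj : injective f.
  move=> i j /complexI /(mulfI (lt0r_neq0 e0)) /invr_inj /eqP.
  by rewrite eqr_nat => /eqP [].
have u : uniq (map f (iota 0 (size p))) by rewrite map_inj_uniq ?iota_uniq.
have := max_poly_roots p0 (rs := map f (iota 0 (size p))).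
rewrite u size_map size_iota ltnn => h.
have /allPn [_ /mapP [i _ ->] ri] : ~~ all (root p) (map f (iota 0 (size p))).
  by apply/negP => al; have := h al isT.
exists (e / i.+2%:R); split=> //; first by rewrite divr_gt0.
by rewrite ltr_pdivrMr// ltr_pMr// ltr1n.
Qed.

Lemma small_noneigenvalue k (N : 'M[C]_k) (e : R) : 0 < e ->
  exists s : R, [/\ 0 < s, s < e & N - ((s%:C)%C)%:M \in unitmx].
Proof.
move=> e0; have [s [s0 se rs]] := small_nonroot (monic_neq0 (char_poly_monic N)) e0.
exists s; split=> //; rewrite -row_free_unit -kermx_eq0.
by move: rs; rewrite -eigenvalue_root_char /eigenvalue negbK.
Qed.

Lemma left_inverse_restriction n m (B : 'M[C]_(n, m)) r : (r <= \rank B)%N ->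
  exists (W : 'M_(m, r)) (H : 'M_(r, n)), H *m (B *m W) = 1%:M.
Proof.
move=> rB; have [Cl ClC] := row_fullP (col_base_full B).
have [Rr RrR] := row_freeP (row_base_free B).
move: rB Cl Rr ClC RrR (mulmx_base B).
move: (\rank B) (col_base B) (row_base B) => rho Cb Rb rB Cl Rr ClC RrR eB.
exists (Rr *m pid_mx r), (pid_mx r *m Cl).
rewrite -eB -!mulmxA (mulmxA Cl) ClC mul1mx (mulmxA Rb) RrR mul1mx.
by rewrite mul_pid_mx minnn (minn_idPr rB) pid_mx_1.
Qed.

(** The pencil [A - lambda B] may be singular, and then the invariant subspace spanned by
    [V] need not carry any eigenvalue.  Consider, with [K] and [Z] fixed,
    [A' = (A + t Z) (1 + t K)^-1] and [V' = (1 + t K) V].  As [rank B >= r], [K] can be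
    taken such that [B K V] is injective; then [Z] can be chosen so that [A' V' = B V' D]
    for every [t] and so that [Y = Z - a B K] is injective.  Since
    [(A' - a B) (1 + t K) = A - a B + t Y], all but finitely many [t] give an injective
    matrix, and [A'] tends to [A] with [t]. *)
Lemma perturb_injective n m r (A B : 'M[C]_(n, m)) (V : 'M[C]_(m, r)) (D : 'M[C]_r) (e : R) :
  (m <= n)%N -> (r <= \rank B)%N -> \rank V = r -> A *m V = B *m V *m D -> 0 < e ->
  exists (A' : 'M_(n, m)) (V' : 'M_(m, r)) a L,
    [/\ specnorm (A' - A) <= e, \rank V' = r, A' *m V' = B *m V' *m D
      & L *m (A' - a *: B) = 1%:M].
Proof.
move=> mn rB rV AV e0.
have [G GV] : exists G, G *m V = 1%:M.
  by apply/row_fullP; rewrite /row_full rV.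
have [W [H HBW]] := left_inverse_restriction rB.
have [a [_ _ Dau]] := small_noneigenvalue D (ltr01 : (0 : R) < 1).
move: (a%:C)%C Dau => {}a Dau.
have [q [V2 [G2 [G2V2 GV2 G2V VGV2G2 rq]]]] := split_complement GV.
have [q' [W2 [H2 [H2W2 HW2 H2W _ rq']]]] := split_complement HBW.
(* Y is prescribed on the image of V by the invariance equation, and maps a complement
   injectively into a complement of the image of B W; this uses m <= n. *)
pose Y := B *m W *m (D - a%:M) *m G + W2 *m pid_mx q *m G2.
pose L := V *m invmx (D - a%:M) *m H + V2 *m pid_mx q *m H2.
have HY : H *m Y = (D - a%:M) *m G.
  by rewrite mulmxDr !(mulmxA H) -(mulmxA H B) HBW HW2 !mul0mx mul1mx addr0.
have H2Y : H2 *m Y = pid_mx q *m G2.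
  by rewrite mulmxDr !(mulmxA H2) -(mulmxA H2 B) H2W H2W2 !mul0mx mul1mx add0r.
have LY : L *m Y = 1%:M.
  rewrite mulmxDl -(mulmxA _ H) HY -(mulmxA _ H2) H2Y -VGV2G2; congr (_ + _).
    by rewrite mulmxA mulmxKV.
  by rewrite -!mulmxA (mulmxA (pid_mx q)) mul_pid_mx minnn (minn_idPr _) ?pid_mx_1 ?mul1mx//; lia.
pose K := W *m G.
have KV : K *m V = W by rewrite -mulmxA GV mulmx1.
pose Z := Y + a *: (B *m K).
have ZV : Z *m V = B *m W *m D.
  rewrite mulmxDl -scalemxAl -(mulmxA B) KV mulmxDl -!(mulmxA _ _ V) GV G2V mulmx0 addr0 mulmx1.
  by rewrite mulmxBr mul_mx_scalar subrK.
pose kK := specnorm K ^+ 2; pose X := Z - A *m K.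
have kK0 : 0 <= kK by apply: sqr_ge0.
have sX0 : 0 <= specnorm X := sigma_ge0 _ _.
(* The first bound makes A' - A small, the second keeps 1 + t K invertible. *)
pose eta := Num.min (e / (2 * specnorm X + 1)) ((3 / 4) / (1 + kK)).
have eta0 : 0 < eta.
  by rewrite lt_min; apply/andP; split; apply: divr_gt0 => //; lra.
have [t [t0 teta Nu]] := small_noneigenvalue (- (L *m (A - a *: B))) eta0.
move: teta; rewrite lt_min => /andP [t1 t2].
pose tc : C := (t%:C)%C.
pose T := 1%:M + tc *: K.
have T_below y : sqn y <= 4 * sqn (T *m y).
  rewrite /T mulmxDl mul1mx -scalemxAl sqnD sqnZ nsqR rdotZr.
  have := specnorm_bound K y (leqnn m); rewrite -/kK => hK.
  have := rdot_amgm y (K *m y) (ltr01 : (0 : R) < 1); rewrite invr1 !mul1r => h2.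
  have hK0 := sqn_ge0 (K *m y); have y0 := sqn_ge0 y.
  have h3 : t * (- (sqn y + kK * sqn y)) <= t * (2 * rdot y (K *m y)).
    by rewrite ler_pM2l//; lra.
  have h4 : t * (1 + kK) <= 3 / 4.
    by rewrite -ler_pdivlMr ?ltW// ltr_pwDl.
  have h5 : t * (1 + kK) * sqn y <= 3 / 4 * sqn y by rewrite ler_wpM2r.
  have h6 : 0 <= t ^+ 2 * sqn (K *m y) by rewrite mulr_ge0 ?sqr_ge0.
  lra.
have Tu : T \in unitmx.
  apply: unitmx_of_injective => x Tx; apply/eqP.
  by rewrite -sqn_eq0 eq_le sqn_ge0 andbT; have := T_below x; rewrite Tx sqn0 mulr0.
pose A' := (A + tc *: Z) *m invmx T.
have A'T : A' *m T = A + tc *: Z by rewrite mulmxKV.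
have A'AT : (A' - A) *m T = tc *: X.
  rewrite mulmxBl A'T /T mulmxDr mulmx1 -scalemxAr /X scalerBr opprD addrACA.
  by rewrite addrN add0r.
pose Mt := A - a *: B + tc *: Y.
have A'aT : (A' - a *: B) *m T = Mt.
  rewrite mulmxBl A'T -scalemxAl /T mulmxDr mulmx1 -scalemxAr /Mt /Z.
  rewrite !scalerDr !scalerA (mulrC tc a) opprD addrACA; congr (_ + _).
  by rewrite addrK.
have LMu : L *m Mt \in unitmx.
  rewrite /Mt mulmxDr -scalemxAr LY scalemx1 -[X in X \in _]opprK unitmxE -scaleN1r detZ unitrM.
  by rewrite -unitmxE opprD Nu unitrX ?unitrN1.
exists A', (T *m V), a, (T *m invmx (L *m Mt) *m L); split.
- apply: specnorm_le => //; first exact: ltW.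
  move=> x; rewrite -{1}(mulKVmx Tu x) (mulmxA (A' - A)) A'AT -scalemxAl sqnZ nsqR.
  have := T_below (invmx T *m x); rewrite mulKVmx//.
  move: (invmx T *m x) => y hy.
  have hX := specnorm_bound X y mn.
  have h1 : t * (2 * specnorm X) <= e.
    apply: le_trans (_ : t * (2 * specnorm X + 1) <= _).
      by rewrite ler_pM2l//; lra.
    by rewrite -ler_pdivlMr ?ltW//; lra.
  apply: le_trans (_ : (t * (2 * specnorm X)) ^+ 2 * sqn x <= _); last first.
    rewrite ler_wpM2r ?sqn_ge0// ler_pXn2r// nnegrE ?mulr_ge0// ltW//.
  rewrite (_ : _ * sqn x = t ^+ 2 * (specnorm X ^+ 2 * (4 * sqn x))); last by ring.
  rewrite ler_wpM2l ?sqr_ge0//; apply: le_trans hX _.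
  by rewrite ler_wpM2l ?sqr_ge0.
- by rewrite eqmxMfull // row_full_unit.
- rewrite mulmxA A'T mulmxDl -scalemxAl ZV AV /T mulmxDl mul1mx -scalemxAl KV.
  by rewrite mulmxDr mulmxDl -scalemxAr -scalemxAl.
- rewrite -[A' - _](mulmxK Tu) A'aT -!mulmxA (mulmxA L) (mulmxA (invmx (L *m Mt))) mulVmx//.
  by rewrite mul1mx mulmxV.
Qed.

End Perturb.

(** * The block matrix as a generalized Sylvester operator *)

Section Stacking.
Variable R : realType.
Local Notation C := R[i].

Lemma dot_vec_stack m r (X Y : 'M[C]_(m, r)) :
  (vec_stack X) ^t* *m vec_stack Y = (\tr (X ^t* *m Y))%:M.
Proof.
have -> : (vec_stack X) ^t* = \mxrow_(j < r) ((col j X) ^t*).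
  by apply/matrixP => i j; rewrite !mxE.
rewrite mul_mxrow_mxcol; apply/matrixP => i j.
rewrite !ord1 summxE !mxE eqxx mulr1n; apply: eq_bigr => l _.
by rewrite !mxE; apply: eq_bigr => k _; rewrite !mxE.
Qed.

Lemma sqn_vec_stack m r (X : 'M[C]_(m, r)) : sqn (vec_stack X) = \sum_j sqn (col j X).
Proof.
rewrite /sqn -Re_dot dot_vec_stack mxE eqxx mulr1n Re_sum; apply: eq_bigr => j _.
rewrite -Re_dot !mxE; congr complex.Re; by apply: eq_bigr => k _; rewrite !mxE.
Qed.

Definition unstack m r (U : 'cV[C]_(\sum_(j < r) m)) : 'M[C]_(m, r) :=
  \matrix_(i, j) submxcol U j i 0.

Lemma unstackK m r (U : 'cV[C]_(\sum_(j < r) m)) : vec_stack (unstack U) = U.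
Proof.
rewrite -[RHS]submxcolK; apply: eq_mxcol => j.
by apply/matrixP => i l; rewrite !ord1 !mxE.
Qed.

Lemma vec_stack_inj m r : injective (@vec_stack R m r).
Proof.
move=> X Y e; apply/matrixP => i j.
have := congr1 (fun U : 'cV_(\sum_(j < r) m) => submxcol U j i 0) e.
by rewrite /vec_stack !mxcolK !mxE.
Qed.

Lemma vec_stackD m r (X Y : 'M[C]_(m, r)) : vec_stack (X + Y) = vec_stack X + vec_stack Y.
Proof. by rewrite /vec_stack -mxcolD; apply: eq_mxcol => j; apply/matrixP => i l; rewrite !mxE. Qed.

Lemma vec_stackZ m r a (X : 'M[C]_(m, r)) : vec_stack (a *: X) = a *: vec_stack X.
Proof. by apply/matrixP => i j; rewrite !mxE. Qed.

(** The upper triangular matrix [C] for which the block matrix acts on stacked columns as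
    [X |-> A X - B X C]. *)
Definition Lcoef r (mu : 'cV[C]_r) (Gamma : params R r) : 'M[C]_r :=
  \matrix_(j, i) (if i == j then mu i 0 else - gamma_entry Gamma i j).

Lemma gamma_entry_upper r (Gamma : params R r) (i j : 'I_r) : (i <= j)%N -> gamma_entry Gamma i j = 0.
Proof. by move=> ij; rewrite /gamma_entry insubF//= ltnNge ij. Qed.

Lemma Lcoef_upper r (mu : 'cV[C]_r) Gamma (i j : 'I_r) : (j < i)%N -> Lcoef mu Gamma i j = 0.
Proof.
move=> ji; rewrite mxE; case: eqP => [e|_]; first by rewrite e ltnn in ji.
by rewrite gamma_entry_upper ?oppr0// ltnW.
Qed.

Lemma Lcoef_diag r (mu : 'cV[C]_r) Gamma (i : 'I_r) : Lcoef mu Gamma i i = mu i 0.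
Proof. by rewrite mxE eqxx. Qed.

Lemma Lmat_vec_stack n m r (mu : 'cV[C]_r) Gamma (A B : 'M[C]_(n, m)) X :
  Lmat mu Gamma A B *m vec_stack X = vec_stack (A *m X - B *m X *m Lcoef mu Gamma).
Proof.
rewrite /Lmat mxblockEv mxcol_mul; apply: eq_mxcol => i.
rewrite mul_mxrow_mxcol.
rewrite (eq_bigr (fun j => (if i == j then col i (A *m X) else 0) -
                           Lcoef mu Gamma j i *: col j (B *m X))); last first.
  move=> j _; rewrite mxE; have [<-|ij] := eqVneq i j.
    by rewrite mulmxBl -scalemxAl !mulmx_col.
  by rewrite -scalemxAl mulmx_col scaleNr sub0r opprK.
rewrite sumrB -big_mkcond /=.
rewrite (eq_bigl (pred1 i)) ?big_pred1_eq; last by move=> j; rewrite /= eq_sym.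
move: (A *m X) (B *m X) (Lcoef mu Gamma) => AX BX Lc.
apply/colP => k; rewrite !mxE summxE; congr (_ - _); apply: eq_bigr => j _.
by rewrite !mxE mulrC.
Qed.

Definition block_unit n m r (B : 'M[C]_(n, m)) (i j : 'I_r) :
    'M[C]_(\sum_(i < r) n, \sum_(j < r) m) :=
  \mxblock_(i' < r, j' < r) (if (i' == i) && (j' == j) then B else 0).

Lemma block_unit_vec n m r (B : 'M[C]_(n, m)) (i j : 'I_r) X :
  block_unit B i j *m vec_stack X = vec_stack (B *m X *m delta_mx j i).
Proof.
rewrite /block_unit mxblockEv mxcol_mul; apply: eq_mxcol => i'.
rewrite mul_mxrow_mxcol (bigD1 j)//= big1 => [|l /negPf lj]; last by rewrite lj andbF mul0mx.
rewrite eqxx andbT addr0 [RHS]colE -mulmxA mul_delta_mx_cond eq_sym.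
case: eqP => _; last by rewrite mulr0n mulmx0 mul0mx.
by rewrite mulr1n -colE mulmx_col.
Qed.

Definition params_add r (Gamma : params R r) (i j : 'I_r) (t : C) : params R r :=
  [ffun ij => Gamma ij + (if val ij == (i, j) then t else 0)].

Lemma Lmat_params_add n m r (mu : 'cV[C]_r) Gamma (A B : 'M[C]_(n, m)) (i j : 'I_r) t :
  (j < i)%N ->
  Lmat mu (params_add Gamma i j t) A B = Lmat mu Gamma A B + t *: block_unit B i j.
Proof.
move=> ji; apply/matrixP => a b; rewrite !mxE.
set k := tagnat.sig1 a; set l := tagnat.sig1 b.
have [kl|kl] := eqVneq k l.
  rewrite ifF ?mxE ?mulr0 ?addr0//.
  by apply/negP => /andP [/eqP ki /eqP lj]; rewrite -ki -lj kl ltnn in ji.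
rewrite !mxE /gamma_entry; case: insubP => [kl' _ ekl|nkl].
  rewrite ffunE ekl xpair_eqE mulrDl; congr (_ + _).
  by case: ifP => _; rewrite ?mxE ?mul0r ?mulr0.
rewrite mul0r add0r ifF ?mxE ?mulr0//.
by apply/negP => /andP [/eqP ki /eqP lj]; move: nkl; rewrite /= ki lj ji.
Qed.

Section UpperTriangular.
Variable r : nat.
Implicit Types T Y : 'M[C]_r.

Definition upper T := forall i j : 'I_r, (j < i)%N -> T i j = 0.

Lemma upper_mul T Y (i j : 'I_r) : upper T -> upper Y -> (j <= i)%N ->
  (T *m Y) i j = if i == j then T i i * Y i i else 0.
Proof.
move=> Tu Yu ji; rewrite mxE; have [<-|ij] := eqVneq i j.
  rewrite (bigD1 i) //= big1 ?addr0// => k ki.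
  have [lt|ge] := ltnP k i; first by rewrite Tu// mul0r.
  by rewrite Yu ?mulr0// ltn_neqAle ge andbT eq_sym.
rewrite big1// => k _; have [lt|ge] := ltnP k i; first by rewrite Tu// mul0r.
rewrite Yu ?mulr0//; apply: leq_trans ge; rewrite ltn_neqAle ji andbT.
by rewrite eq_sym.
Qed.

Lemma upper_sub_scalar_unit T x : upper T -> (forall i, T i i != x) -> T - x%:M \in unitmx.
Proof.
move=> Tu Tx; rewrite -unitmx_tr unitmxE det_trig; last first.
  apply/is_trig_mxP => i j ij; rewrite !mxE Tu// -val_eqE /= gtn_eqF//.
  by rewrite mulr0n subr0.
rewrite unitfE; apply/prodf_neq0 => i _; rewrite !mxE eqxx mulr1n subr_eq0.
exact: Tx.
Qed.

Variables T D : 'M[C]_r.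

(** A linear map without diagonal entries in its values, whose kernel consists of the upper
    triangular [Y] with [T Y = Y D] when [T] and [D] are upper triangular with the same
    diagonal. *)
Definition intertwining_defect (Y : 'M[C]_r) : 'M[C]_r :=
  \matrix_(i, j) (if (i < j)%N then (T *m Y - Y *m D) i j else if (j < i)%N then Y i j else 0).

Fact intertwining_defect_is_linear : linear intertwining_defect.
Proof.
move=> a X Y; rewrite /intertwining_defect.
have -> : T *m (a *: X + Y) - (a *: X + Y) *m D =
    a *: (T *m X - X *m D) + (T *m Y - Y *m D).
  by rewrite mulmxDr mulmxDl -scalemxAr -scalemxAl scalerBr opprD addrACA.
move: (T *m X - X *m D) (T *m Y - Y *m D) => FX FY.
apply/matrixP => i j; rewrite !mxE.
by case: ifP => _ //; case: ifP => _ //; rewrite mulr0 addr0.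
Qed.

HB.instance Definition _ := GRing.isLinear.Build C 'M[C]_r 'M[C]_r _ _
  intertwining_defect_is_linear.

(** All values have zero diagonal, so the kernel has dimension at least [r]. *)
Lemma rank_intertwining : (r <= \rank (kermx (lin_mx intertwining_defect)))%N.
Proof.
(* dg extracts the diagonal of a matrix given in vectorized form. *)
pose dg : 'M[C]_(r * r, r) := \matrix_(k, i) (vec_mx (delta_mx 0 k) : 'M[C]_r) i i.
have dgE (v : 'rV[C]_(r * r)) i : (v *m dg) 0 i = vec_mx v i i.
  rewrite mxE [in RHS](row_sum_delta v) linear_sum /= summxE; apply: eq_bigr => k _.
  by rewrite linearZ /= !mxE.
have d0 : lin_mx intertwining_defect *m dg = 0.
  apply/row_matrixP => k; rewrite row0 rowE mulmxA mul_rV_lin.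
  by apply/rowP => i; rewrite dgE mxvecK !mxE !ltnn.
have rdg : \rank dg = r.
  have : (\matrix_i mxvec (delta_mx i i : 'M[C]_r)) *m dg = 1%:M.
    apply/row_matrixP => i; rewrite row_mul rowK; apply/rowP => j.
    by rewrite dgE mxvecK !mxE andbb eq_sym.
  move=> e; apply/eqP; rewrite eqn_leq rank_leq_col /= -{1}(mxrank1 C r) -e.
  exact: mxrankM_maxr.
have := mulmx0_rank_max d0; rewrite mxrank_ker rdg; lia.
Qed.

Lemma intertwining_defect0 Y : upper T -> upper D -> (forall i, T i i = D i i) ->
  intertwining_defect Y = 0 -> T *m Y = Y *m D.
Proof.
move=> Tu Du TD e.
have Yu : upper Y.
  by move=> i j ji; have /matrixP/(_ i j) := e; rewrite !mxE ltnNge (ltnW ji) /= ji.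
apply/matrixP => i j; have [ij|ji] := ltnP i j.
  have /matrixP/(_ i j) := e; rewrite [LHS]mxE [RHS]mxE ij.
  by rewrite mxE [X in _ + X]mxE => /eqP; rewrite subr_eq0 => /eqP.
by rewrite !upper_mul//; case: eqP => // _; rewrite TD mulrC.
Qed.

End UpperTriangular.

End Stacking.

(** * The two inequalities *)

Section Bounds.
Variable R : realType.
Local Notation C := R[i].
Variables (n m : nat).
Hypothesis mn : (m <= n)%N.

Lemma leq_Lmat r : (\sum_(j < r) m <= \sum_(i < r) n)%N.
Proof. exact: leq_sum. Qed.

Definition stacked r (X : 'M[C]_(m, r)) (v : 'rV[C]_(r * r)) : 'rV[C]_(\sum_(j < r) m) :=
  (vec_stack (X *m vec_mx v))^T.

Fact stacked_is_linear r X : linear (@stacked r X).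
Proof.
move=> a u v; rewrite /stacked linearP mulmxDr -scalemxAr vec_stackD vec_stackZ.
by rewrite linearD linearZ.
Qed.

HB.instance Definition _ r X := GRing.isLinear.Build C 'rV[C]_(r * r) 'rV[C]_(\sum_(j < r) m) _ _
  (@stacked_is_linear r X).

(** For every upper triangular [Y] with [T Y = Y C] the stacked [X Y] is in the kernel of
    the block matrix of the perturbed pencil.  These [Y] form a space of dimension at
    least [r], on which the unperturbed block matrix differs from zero by copies of [D]. *)
Lemma sigmaL_le r (A D B : 'M[C]_(n, m)) (X : 'M[C]_(m, r)) X' (T : 'M[C]_r) (mu : 'cV[C]_r) Gamma :
  X' *m X = 1%:M -> (A + D) *m X = B *m X *m T -> upper T -> (forall i, mu i 0 = T i i) ->
  sigmaL A B mu Gamma <= specnorm D.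
Proof.
move=> XX eX Tu muT; set Lc := Lcoef mu Gamma.
have Lu : upper Lc by move=> i j; apply: Lcoef_upper.
have TL i : T i i = Lc i i by rewrite Lcoef_diag.
pose V := kermx (lin_mx (intertwining_defect T Lc)) *m lin1_mx (stacked X).
have rV : (r <= \rank V)%N.
  rewrite mxrankMfree; first exact: rank_intertwining.
  apply: row_free_of_injective => v; rewrite mul_rV_lin1 /stacked => /(congr1 trmx).
  rewrite trmxK trmx0 => v0.
  have : X *m vec_mx v = 0.
    apply: (@vec_stack_inj R); rewrite v0; apply/matrixP => a b.
    by rewrite !mxE.
  move=> /(congr1 (mulmx X')); rewrite mulmxA XX mul1mx mulmx0 => /(congr1 mxvec).
  by rewrite vec_mxK linear0.
have dimV : (\sum_(j < r) m < m * r - r + 1 + \rank V)%N.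
  have e : (\sum_(j < r) m = m * r)%N by rewrite sum_nat_const card_ord mulnC.
  by apply: (leq_ltn_trans (eq_leq e)); move: (\rank V) rV; lia.
apply: (sigma_le (leq_Lmat r) (sigma_ge0 _ _) _ dimV); first by rewrite addn1.
move=> v /submxP [u ->]; rewrite /V mulmxA mul_rV_lin1.
set w := u *m kermx _.
have w0 : w *m lin_mx (intertwining_defect T Lc) = 0 by rewrite -mulmxA mulmx_ker mulmx0.
rewrite mul_rV_lin in w0.
have : intertwining_defect T Lc (vec_mx w) = 0.
  by apply: (can_inj mxvecK); rewrite w0 linear0.
rewrite /stacked trmxK; move: (vec_mx w) => Y /(intertwining_defect0 Tu Lu TL) TY.
have eZ : (A + D) *m (X *m Y) = B *m (X *m Y) *m Lc.
  by rewrite mulmxA eX -!mulmxA TY.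
move: (X *m Y) eZ => Z eZ.
have -> : Lmat mu Gamma A B *m vec_stack Z = vec_stack (- D *m Z).
  rewrite Lmat_vec_stack -/Lc -eZ mulmxDl mulNmx; congr vec_stack.
  by rewrite opprD addNKr.
rewrite !sqn_vec_stack mulr_sumr; apply: ler_sum => j _.
rewrite (_ : col j (- D *m Z) = - (D *m col j Z)).
  rewrite -scaleN1r sqnZ (_ : nsq (-1) = 1) ?mul1r; first exact: specnorm_bound.
  by rewrite /nsq /= oppr0 expr0n sqrrN expr1n addr0.
by rewrite mulNmx !colE mulNmx mulmxA.
Qed.

(** The eigenvalues, listed along the diagonal of the triangular matrix of an invariant
    subspace, serve as [mu]. *)
Lemma lower_bound r (A D B : 'M[C]_(n, m)) (S : {fset C}) : (0 < r)%N ->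
  (r <= \sum_(l <- S) algmult (A + D)%R B l)%N ->
  exists2 mu : 'cV[C]_r, (forall i, mu i 0 \in S) &
    forall Gamma, sigmaL A B mu Gamma <= specnorm D.
Proof.
move=> r0; rewrite sum_algmult => rS.
have [[s hs]|ns] := pselect (exists s, is_kcf (A + D) B s); last first.
  move: rS; rewrite /kcf xgetPN ?big_nil; first by case: r r0.
  by move=> s hs; apply: ns; exists s.
have hk : is_kcf (A + D) B (kcf (A + D) B) by apply: (xgetPex [::]); exists s.
have [X [X' [T [XX eX Tu TS]]]] := is_kcf_invariant hk rS.
exists (\col_i T i i) => [i|Gamma]; first by rewrite mxE; apply: TS.
by apply: (sigmaL_le Gamma XX eX Tu) => i; rewrite mxE.
Qed.

(** Strict positivity of the bounds lets the cross term be split with weight [b / a]. *)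
Lemma specnorm_add (D E : 'M[C]_(n, m)) a b : 0 < a -> 0 < b ->
  specnorm D <= a -> specnorm E <= b -> specnorm (D + E) <= a + b.
Proof.
move=> a0 b0 Da Eb; apply: specnorm_le => //; first by rewrite addr_ge0 ?ltW.
have bd (F : 'M[C]_(n, m)) c x : specnorm F <= c -> sqn (F *m x) <= c ^+ 2 * sqn x.
  move=> Fc; apply: le_trans (specnorm_bound F x mn) _; rewrite ler_wpM2r ?sqn_ge0//.
  by rewrite ler_pXn2r// nnegrE ?(le_trans _ Fc) ?sigma_ge0.
move=> x; rewrite mulmxDl sqnD.
have hD := bd _ _ x Da; have hE := bd _ _ x Eb.
(* The weight b / a balances the two terms of the splitting. *)
have ba0 : 0 < b / a by rewrite divr_gt0.
have := rdot_amgm (- (D *m x)) (E *m x) ba0.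
have -> : rdot (- (D *m x)) (E *m x) = - rdot (D *m x) (E *m x).
  by rewrite -scaleN1r -[-1](rmorphN1 (real_complex R)) rdotZl mulN1r.
have -> : sqn (- (D *m x)) = sqn (D *m x).
  by rewrite -scaleN1r -[-1](rmorphN1 (real_complex R)) sqnZ nsqR sqrrN expr1n mul1r.
rewrite invf_div => h.
have h1 : b / a * sqn (D *m x) <= a * b * sqn x.
  apply: le_trans (_ : b / a * (a ^+ 2 * sqn x) <= _); first by rewrite ler_pM2l.
  by rewrite le_eqVlt; apply/orP; left; apply/eqP; field; rewrite gt_eqF.
have h2 : a / b * sqn (E *m x) <= a * b * sqn x.
  apply: le_trans (_ : a / b * (b ^+ 2 * sqn x) <= _); first by rewrite ler_pM2l ?divr_gt0.
  by rewrite le_eqVlt; apply/orP; left; apply/eqP; field; rewrite gt_eqF.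
lra.
Qed.

Lemma gram_unit r (X : 'M[C]_(m, r)) : \rank X = r -> X ^t* *m X \in unitmx.
Proof.
move=> rX; have [X' XX] : exists G, G *m X = 1%:M.
  by apply/row_fullP; rewrite /row_full rX.
apply: unitmx_of_injective => x Xx.
have Xx0 : X *m x = 0.
  apply/eqP; rewrite -sqn_eq0 /sqn -Re_dot trmxCM -mulmxA (mulmxA (X ^t*)) Xx mulmx0.
  by rewrite mxE.
by rewrite -[x]mul1mx -XX -mulmxA Xx0 mulmx0.
Qed.

(** The vector on the left is the orthogonal projection of [x] on the column space of [X]. *)
Lemma projection_contract r (X : 'M[C]_(m, r)) x : \rank X = r ->
  sqn (X *m (invmx (X ^t* *m X) *m X ^t* *m x)) <= sqn x.
Proof.
move=> rX; have Gu := gram_unit rX.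
pose z := invmx (X ^t* *m X) *m (X ^t* *m x).
have -> : invmx (X ^t* *m X) *m X ^t* *m x = z by rewrite /z mulmxA.
have h0 : X ^t* *m (x - X *m z) = 0.
  by rewrite mulmxBr mulmxA /z mulKVmx// subrr.
have {1}-> : x = X *m z + (x - X *m z) by rewrite addrC subrK.
by rewrite sqnD rdot_adj h0 rdot0r mulr0 addr0 lerDl sqn_ge0.
Qed.

Lemma hermitian_lower_zero r (H : 'M[C]_r) : H ^t* = H ->
  (forall i j : 'I_r, (j <= i)%N -> H i j = 0) -> H = 0.
Proof.
move=> HH H0; apply/matrixP => i j; rewrite [RHS]mxE.
have [ji|ij] := leqP j i; first exact: H0.
by rewrite -HH !mxE H0 ?conjC0// ltnW.
Qed.

Lemma trace_nondegenerate p q (Q : 'M[C]_(p, q)) : (forall X, \tr (Q *m X) = 0) -> Q = 0.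
Proof.
move=> h; apply/matrixP => i j; have := h (delta_mx j i).
rewrite /mxtrace (bigD1 i) //= big1 ?addr0 => [|k ki]; rewrite !mxE.
  rewrite (bigD1 j)//= big1 ?addr0 => [|l lj]; rewrite !mxE ?eqxx ?mulr1//.
  by rewrite (negPf lj) mulr0.
by apply: big1 => l _; rewrite !mxE (negPf ki) andbF mulr0.
Qed.

Section Optimum.
Variables (r : nat) (A B : 'M[C]_(n, m)) (mu : 'cV[C]_r) (Gamma : params R r).
Hypothesis opt : forall G, sigmaL A B mu G <= sigmaL A B mu Gamma.
Hypothesis simple : mult_qualif A B mu Gamma.
Variables (X : 'M[C]_(m, r)) (Y : 'M[C]_(n, r)).
Local Notation sg := (sigmaL A B mu Gamma).
Local Notation L := (Lmat mu Gamma A B).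
Hypothesis sg0 : 0 < sg.
Hypothesis YY : (vec_stack Y) ^t* *m vec_stack Y = 1%:M.
Hypothesis XX : (vec_stack X) ^t* *m vec_stack X = 1%:M.
Hypothesis LX : L *m vec_stack X = (sg%:C)%C *: vec_stack Y.
Hypothesis LY : L ^t* *m vec_stack Y = (sg%:C)%C *: vec_stack X.

(** A nonzero entry below the diagonal would be a nonzero derivative of the simple singular
    value in the direction of one of the parameters. *)
Lemma optimum_upper : upper (Y ^t* *m B *m X).
Proof.
move=> i j ji; apply/eqP; apply: contraT => w0.
have e : ((vec_stack Y) ^t* *m block_unit B i j *m vec_stack X) 0 0 = (Y ^t* *m B *m X) i j.
  rewrite -mulmxA block_unit_vec dot_vec_stack mxE eqxx mulr1n !mulmxA.
  move: (Y ^t* *m B *m X) => Q.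
  rewrite /mxtrace (bigD1 i) //= big1 ?addr0 => [|k ki]; rewrite mxE.
    rewrite (bigD1 j)//= big1 ?addr0 => [|l lj]; rewrite !mxE ?eqxx ?mulr1//.
    by rewrite (negPf lj) mulr0.
  by apply: big1 => l _; rewrite !mxE (negPf ki) andbF mulr0.
have [t] : exists t : C, sg < sigma (m * r - r + 1) (L + t *: block_unit B i j).
  apply: (sigma_increase (leq_Lmat r) _ sg0 simple YY XX LX LY); first by rewrite addn1.
  by rewrite e.
rewrite -Lmat_params_add// => lt.
by have := opt (params_add Gamma i j t); rewrite leNgt lt.
Qed.

Lemma optimum_right : A *m X - B *m X *m Lcoef mu Gamma = (sg%:C)%C *: Y.
Proof. by apply: (@vec_stack_inj R); rewrite -Lmat_vec_stack LX vec_stackZ. Qed.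

(** The adjoint equation tested against all stacked matrices. *)
Lemma optimum_left :
  Y ^t* *m A - Lcoef mu Gamma *m Y ^t* *m B = (sg%:C)%C *: X ^t*.
Proof.
apply/eqP; rewrite -subr_eq0; apply/eqP/trace_nondegenerate => Z.
have := congr1 (fun M => M ^t* *m vec_stack Z) LY.
rewrite /= trmxCM trmxCK -mulmxA Lmat_vec_stack trmxCZ conj_real_complex -scalemxAl.
rewrite !dot_vec_stack scale_scalar_mx => /matrixP/(_ 0 0); rewrite !mxE eqxx !mulr1n => e.
have -> : \tr ((Y ^t* *m A - Lcoef mu Gamma *m Y ^t* *m B - (sg%:C)%C *: X ^t*) *m Z) =
    \tr (Y ^t* *m (A *m Z - B *m Z *m Lcoef mu Gamma)) - (sg%:C)%C * \tr (X ^t* *m Z).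
  rewrite !mulmxBl -scalemxAl 2!raddfB /= linearZ /= mulmxBr raddfB /= -!mulmxA.
  by rewrite [in X in _ - X - _]mxtrace_mulC !mulmxA.
by rewrite e subrr.
Qed.

(** With [T = Y^* B X], the two singular vector equations give
    [sigma (Y^* Y - X^* X) = C T - T C].  Both [C] and [T] are upper triangular, so the
    commutator is strictly upper triangular; being also Hermitian, it vanishes. *)
Lemma optimum_gram : Y ^t* *m Y = X ^t* *m X.
Proof.
set Lc := Lcoef mu Gamma; set T := Y ^t* *m B *m X.
have e1 : Y ^t* *m A *m X - T *m Lc = (sg%:C)%C *: (Y ^t* *m Y).
  by rewrite scalemxAr -optimum_right mulmxBr /T !mulmxA.
have e2 : Y ^t* *m A *m X - Lc *m T = (sg%:C)%C *: (X ^t* *m X).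
  by rewrite scalemxAl -optimum_left mulmxBl /T !mulmxA.
have e3 : (sg%:C)%C *: (Y ^t* *m Y - X ^t* *m X) = Lc *m T - T *m Lc.
  by rewrite scalerBr -e1 -e2 opprB addrC addrA addrNK.
apply/eqP; rewrite -subr_eq0; apply/eqP/hermitian_lower_zero.
  by rewrite linearB /= map_mxB !trmxCM !trmxCK.
move=> i j ji.
have Lu : upper Lc by move=> *; apply: Lcoef_upper.
have eU : (Lc *m T - T *m Lc) i j = 0.
  rewrite mxE [X in _ + X]mxE !upper_mul//; try exact: optimum_upper.
  by case: eqP => // _; rewrite ?(mulrC (T i i)) subrr.
have := congr1 (fun M : 'M_r => M i j) e3; rewrite /= eU mxE.
move=> /eqP; rewrite mulf_eq0 => /orP [|/eqP ->//].
by rewrite fmorph_eq0 gt_eqF.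
Qed.
End Optimum.

(** The perturbation [- sigma Y X^+], with [X^+] the pseudo-inverse of [X], satisfies
    [(A + D) X = B X C].  If [sigma > 0], [X] and [Y] have the same Gram matrix, so that its
    norm is at most [sigma]; if [sigma = 0] it vanishes.  An additional arbitrarily small perturbation makes the pencil
    injective somewhere, so that the spectrum of [C] consists of eigenvalues. *)
Lemma upper_bound r (A B : 'M[C]_(n, m)) (S : {fset C}) (mu : 'cV[C]_r) Gamma (e : R) :
  (r <= \rank B)%N -> (forall i, mu i 0 \in S) ->
  (forall G, sigmaL A B mu G <= sigmaL A B mu Gamma) ->
  mult_qualif A B mu Gamma -> linindep_qualif A B mu Gamma -> 0 < e ->
  exists D, specnorm D <= sigmaL A B mu Gamma + e /\
            (r <= \sum_(l <- S) algmult (A + D)%R B l)%N.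
Proof.
move=> rB muS opt simple [X [[U [UU XX LX LU]] rX]] e0.
move: UU LX LU; rewrite -(unstackK U); move: (unstack U) => Y {U} YY LX LY.
set sg := sigmaL A B mu Gamma in opt LX LY *.
have sg0 : 0 <= sg := sigma_ge0 _ _.
set Lc := Lcoef mu Gamma.
have eAX : A *m X - B *m X *m Lc = (sg%:C)%C *: Y := optimum_right LX.
pose G := invmx (X ^t* *m X) *m X ^t*.
have GX : G *m X = 1%:M by rewrite -mulmxA mulVmx// gram_unit.
pose D := - ((sg%:C)%C *: (Y *m G)).
have eD : (A + D) *m X = B *m X *m Lc.
  by rewrite mulmxDl mulNmx -scalemxAl -(mulmxA Y) GX mulmx1 -eAX opprB addrC subrK.
have nD : specnorm D <= sg.
  apply: specnorm_le => // x.
  have -> : sqn (D *m x) = sg ^+ 2 * sqn (Y *m (G *m x)).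
    rewrite mulNmx -scaleN1r -[-1](rmorphN1 (real_complex R)) sqnZ nsqR sqrrN expr1n mul1r.
    by rewrite -scalemxAl sqnZ nsqR -(mulmxA Y).
  have [->|sgn0] := eqVneq sg 0; first by rewrite expr0n /= !mul0r.
  rewrite ler_wpM2l ?sqr_ge0//.
  have sgp : 0 < sg by rewrite lt0r sgn0.
  have gr := optimum_gram opt simple sgp YY XX LX LY.
  rewrite /sqn rdot_adj mulmxA gr -mulmxA -rdot_adj.
  exact: projection_contract.
have e20 : 0 < e / 2 by rewrite divr_gt0.
have [A' [X' [a [L [nA' rX' eA' LA']]]]] := perturb_injective mn rB rX eD e20.
exists (D + (A' - (A + D))); split.
  (* The bound on D is relaxed to sg + e / 2, which is positive even if sg = 0. *)
  have -> : sg + e = (sg + e / 2) + e / 2 by field.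
  apply: specnorm_add => //; first by rewrite ltr_wpDl.
  by apply: le_trans nD _; rewrite lerDl ltW.
have -> : A + (D + (A' - (A + D))) = A' by rewrite addrA addrC subrK.
rewrite sum_algmult.
have [s hs] := kcf_exists LA'.
have hk : is_kcf A' B (kcf A' B) by apply: (xgetPex [::]); exists s.
apply: (is_kcf_spectrum hk _ LA' rX' eA') => x xS.
apply: upper_sub_scalar_unit; first by move=> i j; apply: Lcoef_upper.
move=> i; rewrite Lcoef_diag; apply: contraNneq xS => <-; exact: muS.
Qed.

End Bounds.

(** Any [mu] is compared with the optimum over the finite set of its own entries, where
    the qualifications are available. *)
Lemma tau_eq (R : realType) (n m : nat) (A B : 'M[R[i]]_(n, m)) (r : nat)
    (Hnm : (m <= n)%N) (Hr0 : (0 < r)%N) (HrB : (r <= \rank B)%N) Omega :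
   qualification r A B Omega -> tau r A B Omega = inf_sup_sigmaL r A B Omega.
Proof.
move=> qual; apply/eqP; rewrite eq_le; apply/andP; split.
- apply: le_ereal_inf_tmp => _ [mu muO <-].
  have [S [muS S0 SO]] : exists S : {fset R[i]},
      [/\ forall i, mu i 0 \in S, S != fset0 & [set` S] `<=` Omega].
    have muS i : mu i 0 \in [fset mu i 0 | i : 'I_r]%fset by apply/imfsetP; exists i.
    exists [fset mu i 0 | i : 'I_r]%fset; split=> //.
      by apply/fset0Pn; exists (mu (Ordinal Hr0) 0); apply: muS.
    by move=> x /= /imfsetP [i _ ->].
  have [nu [Gamma [nuS supG supI simple indep]]] := qual S S0 SO.
  have le_mu : (inf_sup_sigmaL r A B [set` S] <= sup_sigmaL A B mu)%E.
    apply: ge_ereal_inf.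
    exists (sup_sigmaL A B mu); last exact: lexx.
    by exists mu => [i|]; [exact: muS|reflexivity].
  apply: le_trans le_mu.
  rewrite -supI -supG; apply/lee_addgt0Pr => e e0.
  have opt G : sigmaL A B nu G <= sigmaL A B nu Gamma.
    by rewrite -lee_fin supG; apply: ereal_sup_ubound; exists G.
  have [D [nD rD]] := upper_bound Hnm HrB nuS opt simple indep e0.
  apply: le_trans (_ : ((specnorm D)%:E <= _)%E); last by rewrite -EFinD lee_fin.
  by apply: ereal_inf_lbound; exists D => //; exists S.
- apply: le_ereal_inf_tmp => _ [D [S [S0 SO rD]] <-].
  have [mu muS hmu] := lower_bound Hnm Hr0 rD.
  apply: le_trans (_ : (sup_sigmaL A B mu <= _)%E).
    by apply: ereal_inf_lbound; exists mu => // i; apply: SO; apply: muS.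
  by apply: ge_ereal_sup => _ [G _ <-]; rewrite lee_fin.
Qed.

Theorem mainTheorem2 (R : realType) (n m : nat) (A B : 'M[R[i]]_(n, m)) (r : nat)
    (Hnm : (m <= n)%N) (Hr0 : (0 < r)%N) (HrB : (r <= \rank B)%N) :
  (forall Omega : set R[i], Omega !=set0 -> qualification r A B Omega ->
     tau r A B Omega = inf_sup_sigmaL r A B Omega)
  /\
  (qualification r A B [set: R[i]] ->
     tau r A B [set: R[i]] = inf_sup_sigmaL r A B [set: R[i]]).
Proof. by split=> [Omega _|]; apply: tau_eq. Qed.
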